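(* Let $\Gamma$ be a max-type gain operator on $\ell^\infty_+(\mathcal I)$. The following are equivalent: (a) there exists a path of strict decay for $\Gamma$; (b) there exists $\rho\in\mathcal K_\infty$ such that $\Sigma(\Gamma_\rho)$ is UGAS. If, in addition, Assumption A holds and there is $M>0$ with $|\mathcal I_i|\le M$ for all $i\in\mathcal I$, then (a) and (b) are also equivalent to: (c) there exists $\rho\in\mathcal K_\infty$ such that all trajectories of $\Sigma(\Gamma_\rho)$ are norm-bounded and $\Gamma_\rho$ satisfies the uniform NJI condition.
   Context: Let $\mathcal I$ be a nonempty countable index set; $\ell^\infty_+(\mathcal I)$ is the cone of nonnegative real families $s=(s_i)_{i\in\mathcal I}$ with $\|s\|:=\sup_i|s_i|<\infty$, ordered componentwise; $\mathbf 1$ is the all-ones vector. $\mathcal K$: continuous strictly increasing $\gamma:\mathbb R_+\to\mathbb R_+$ with $\gamma(0)=0$; $\mathcal K_\infty$: unbounded elements of $\mathcal K$, acting componentwise; $\mathcal{KL}$: continuous $\beta$ with $\beta(\cdot,t)\in\mathcal K$ and $\beta(r,\cdot)$ continuous strictly decreasing to $0$ for $r>0$. Max-type gain operator: for each $i$ a finite (possibly empty) $\mathcal I_i\subset\mathcal I\setminus\{i\}$; directed graph $\mathcal G$ with vertices $\mathcal I$ and edges $ji$, $j\in\mathcal I_i$; a pointwise equicontinuous family $\gamma_{ij}\in\mathcal K_\infty$ ($ji\in E(\mathcal G)$) (for all $r_0\ge0,\varepsilon>0$ there is $\delta>0$ with $|\gamma_{ij}(r)-\gamma_{ij}(r_0)|\le\varepsilon$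 whenever $|r-r_0|\le\delta$, for all edges); $\Gamma_i(s):=\max_{j\in\mathcal I_i}\gamma_{ij}(s_j)$ (interpreted as $0$ if $\mathcal I_i=\emptyset$). $\Gamma_\rho:=(\mathrm{id}+\rho)\circ\Gamma$. Assumption A: there is $\eta\in\mathcal K_\infty$ with $\gamma_{ij}\ge\eta$ for all $ji\in E(\mathcal G)$, and $\mathcal I_i\ne\emptyset$ for all $i$. $\mathcal N^-_i(n)$: vertices $j$ with a directed path from $j$ to $i$ of length at most $n$ ($\mathcal N^-_i(0)=\{i\}$). $\Sigma(T)$ is the system $s^{n+1}=T(s^n)$; UGAS: $\|T^n(s)\|\le\beta(\|s\|,n)$ for some $\beta\in\mathcal{KL}$. $T$ satisfies the uniform NJI condition if for all $r,\varepsilon>0$ there are $n\in\mathbb N$, $\delta>0$ such that for all $s$, $i$ with $s_i\ge\varepsilon$, $\|s\|\le r$ there is $j\in\mathcal N^-_i(n)$ with $s_j\ge\delta$ and $T_j(s)<s_j$. A path of strict decay for $\Gamma$ is a map $\sigma:\mathbb R_+\to\ell^\infty_+(\mathcal I)$ such that: (i) for some $\rho\in\mathcal K_\infty$, $\Gamma_\rho(\sigma(r))\le\sigma(r)$ for all $r\ge0$; (ii) $\varphi_{\min}(r)\mathbf 1\le\sigma(r)\le\varphi_{\max}(r)\mathbf 1$ for some $\varphi_{\min},\varphi_{\max}\in\mathcal K_\infty$; (iii) each $\sigma_i\in\mathcal K_\infty$; (iv) for each compact $K\subset(0,\infty)$ there are $0<l\le L$ with $l|r_1-r_2|\le|\sigma_i^{-1}(r_1)-\sigma_i^{-1}(r_2)|\le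 L|r_1-r_2|$ for all $r_1,r_2\in K$, $i\in\mathcal I$. *)

(* Defs.v *)
From Stdlib Require Import Reals List.
From Coquelicot Require Import Coquelicot.
Import ListNotations.
Open Scope R_scope.

Set Implicit Arguments.

Definition Kfun (g : R -> R) : Prop :=
  g 0 = 0 /\
  (forall x y, 0 <= x -> x < y -> g x < g y) /\
  (forall x, 0 <= x -> forall eps, 0 < eps -> exists delta, 0 < delta /\
     forall y, 0 <= y -> Rabs (y - x) < delta -> Rabs (g y - g x) < eps).

Definition Kinf (g : R -> R) : Prop :=
  Kfun g /\ forall C, exists x, 0 <= x /\ C < g x.

Definition KLfun (beta : R -> R -> R) : Prop :=
  (forall r t, 0 <= r -> 0 <= t -> forall eps, 0 < eps -> exists delta, 0 < delta /\
     forall r' t', 0 <= r' -> 0 <= t' -> Rabs (r' - r) < delta -> Rabs (t' - t) < delta ->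
       Rabs (beta r' t' - beta r t) < eps) /\
  (forall t, 0 <= t -> Kfun (fun r => beta r t)) /\
  (forall r, 0 < r ->
     (forall t1 t2, 0 <= t1 -> t1 < t2 -> beta r t2 < beta r t1) /\
     (forall eps, 0 < eps -> exists T, 0 <= T /\ forall t, T <= t -> Rabs (beta r t) < eps)).

Section Linf.
Variable I : Type.

Definition linf_plus (s : I -> R) : Prop :=
  (forall i, 0 <= s i) /\ exists B, forall i, Rabs (s i) <= B.

Definition snorm (s : I -> R) : R :=
  real (Lub_Rbar (fun x => exists i, x = Rabs (s i))).

Variable Ii : I -> list I.          (* in-neighbours I_i of i *)
Variable gam : I -> I -> R -> R.

Definition max_type_gain : Prop :=
  (forall i, NoDup (Ii i) /\ ~ In i (Ii i)) /\
  (forall i j, In j (Ii i) -> Kinf (gam i j)) /\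
  (forall r0, 0 <= r0 -> forall eps, 0 < eps -> exists delta, 0 < delta /\
     forall i j, In j (Ii i) -> forall r, 0 <= r -> Rabs (r - r0) <= delta ->
       Rabs (gam i j r - gam i j r0) <= eps).

Definition Gam (s : I -> R) : I -> R :=
  fun i => fold_right Rmax 0 (map (fun j => gam i j (s j)) (Ii i)).

Definition Gam_rho (rho : R -> R) (s : I -> R) : I -> R :=
  fun i => Gam s i + rho (Gam s i).

Definition assumptionA : Prop :=
  (exists eta, Kinf eta /\
     forall i j, In j (Ii i) -> forall r, 0 <= r -> eta r <= gam i j r) /\
  (forall i, Ii i <> []).

(* N^-_i(n): j such that there is a directed path from j to i of length <= n
   (edges k -> i for k in I_i) *)
Fixpoint in_nbhd (n : nat) (j i : I) : Prop :=
  match n with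
  | O => j = i
  | S m => in_nbhd m j i \/ exists k, In k (Ii i) /\ in_nbhd m j k
  end.

Definition path_strict_decay (sigma : R -> I -> R) : Prop :=
  (exists rho, Kinf rho /\
     forall r, 0 <= r -> forall i, Gam_rho rho (sigma r) i <= sigma r i) /\
  (exists phimin phimax, Kinf phimin /\ Kinf phimax /\
     forall r, 0 <= r -> forall i, phimin r <= sigma r i /\ sigma r i <= phimax r) /\
  (forall i, Kinf (fun r => sigma r i)) /\
  (* (iv): for every compact K = subset of [a,b] with 0 < a, uniform bi-Lipschitz
     bounds for the inverses sigma_i^{-1} (written through preimages: x_k >= 0 with
     sigma_i(x_k) = r_k, i.e. x_k = sigma_i^{-1}(r_k)) *)
  (forall a b, 0 < a -> a <= b -> exists l L, 0 < l /\ l <= L /\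
     forall i r1 r2 x1 x2, a <= r1 <= b -> a <= r2 <= b ->
       0 <= x1 -> 0 <= x2 -> sigma x1 i = r1 -> sigma x2 i = r2 ->
       l * Rabs (r1 - r2) <= Rabs (x1 - x2) /\ Rabs (x1 - x2) <= L * Rabs (r1 - r2)).

End Linf.

Definition UGAS (I : Type) (T : (I -> R) -> (I -> R)) : Prop :=
  exists beta, KLfun beta /\
    forall s, linf_plus s -> forall n : nat,
      snorm (Nat.iter n T s) <= beta (snorm s) (INR n).

Definition trajectories_bounded (I : Type) (T : (I -> R) -> (I -> R)) : Prop :=
  forall s, linf_plus s -> exists C, forall n : nat, snorm (Nat.iter n T s) <= C.

Definition uniform_NJI (I : Type) (Ii : I -> list I) (T : (I -> R) -> (I -> R)) : Prop :=
  forall r eps, 0 < r -> 0 < eps -> exists (n : nat) delta, 0 < delta /\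
    forall s i, linf_plus s -> eps <= s i -> snorm s <= r ->
      exists j, in_nbhd Ii n j i /\ delta <= s j /\ T s j < s j.

(* Main.v *)
Require Import Defs.
From Stdlib Require Import Reals List.
From Coquelicot Require Import Coquelicot.
From Stdlib Require Import ZArith Lra Lia Classical IndefiniteDescription.
Open Scope R_scope.

(** Everything goes through uniform attractivity: for each [x > 0] the states [T^n (x 1)]
    tend to [0] uniformly in the vertex, where [T] is the operator [Gam_rho].

    Path => UGAS: with [rho / 2] in place of [rho], the slack and the bi-Lipschitz bounds give
    a class-K function [g] with [g r < r] and [T (sigma r) <= sigma (g r)], so [g^n],
    interpolated in [n], yields the KL bound.

    Attractivity => path: suprema of suitable trajectory points form a bi-infinite increasing
    sequence [p_m] of states with [T p_(m+1) <= p_m]. Any state between [p_m] and [p_(m+1)]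
    is then mapped below itself, so linear interpolation gives a path, after a small
    perturbation, paid for by [rho / 2], that makes the increments uniformly positive.

    NJI => attractivity: let [s] be the supremum of the [rho]-trajectory of [x 1]. The
    [rho / 2]-trajectory of [s] decreases. On the neighbourhood of a vertex, which has at most
    [(1 + M)^n] elements, the total decrease is bounded, so at some early time the state is
    almost stationary there, and then adding the missing [rho / 2] gives [T_j u >= u_j]
    wherever [u_j] is not small in the neighbourhood, against NJI.

    UGAS => NJI: if no vertex near [i] decreases, following maximizing in-neighbours back
    [N] steps gives [s_i <= T^N(s)_i], which contradicts attractivity. *)

(** * Comparison functions *)

Lemma Kfun_le (g : R -> R) (x y : R) : Kfun g -> 0 <= x -> x <= y -> g x <= g y.
Proof.
  intros [_ [H _]] Hx [Hxy | ->]; [|lra].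
  apply Rlt_le, H; assumption.
Qed.

Lemma Kfun_pos (g : R -> R) (x : R) : Kfun g -> 0 < x -> 0 < g x.
Proof. intros [H0 [H _]] Hx. rewrite <- H0. apply H; lra. Qed.

Lemma Kfun_nonneg (g : R -> R) (x : R) : Kfun g -> 0 <= x -> 0 <= g x.
Proof. intros Hg Hx. rewrite <- (proj1 Hg). apply Kfun_le; trivial; lra. Qed.

Lemma Kfun_small (g : R -> R) (eps : R) :
  Kfun g -> 0 < eps -> exists d, 0 < d /\ g d < eps.
Proof.
  intros Hg He. destruct Hg as [H0 [Hi Hc]].
  destruct (Hc 0 (Rle_refl 0) eps He) as [d [Hd Hdd]].
  exists (d / 2). split; [lra|].
  specialize (Hdd (d / 2)). rewrite H0, !Rminus_0_r in Hdd.
  rewrite (Rabs_pos_eq (d / 2)) in Hdd by lra.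
  specialize (Hdd ltac:(lra) ltac:(lra)).
  apply Rle_lt_trans with (2 := Hdd), Rle_abs.
Qed.

Lemma Kfun_comp (f g : R -> R) : Kfun f -> Kfun g -> Kfun (fun x => f (g x)).
Proof.
  intros Hf Hg. pose proof Hf as [f0 [fi fc]]. pose proof Hg as [g0 [gi gc]].
  split; [now rewrite g0|]. split.
  - intros x y Hx Hxy. apply fi; [now apply Kfun_nonneg | now apply gi].
  - intros x Hx eps He.
    destruct (fc (g x) (Kfun_nonneg _ _ Hg Hx) eps He) as [d [Hd Hfd]].
    destruct (gc x Hx d Hd) as [d' [Hd' Hgd]].
    exists d'. split; [assumption|]. intros y Hy Hyx.
    apply Hfd; [now apply Kfun_nonneg | now apply Hgd].
Qed.

Lemma Kfun_conic (f g : R -> R) (a b : R) :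
  Kfun f -> Kfun g -> 0 <= a -> 0 <= b -> 0 < a + b ->
  Kfun (fun x => a * f x + b * g x).
Proof.
  intros [f0 [fi fc]] [g0 [gi gc]] Ha Hb Hab.
  split; [rewrite f0, g0; ring|]. split.
  - intros x y Hx Hxy. specialize (fi x y Hx Hxy). specialize (gi x y Hx Hxy).
    destruct (Rle_lt_or_eq_dec 0 a Ha) as [Ha'|<-]; nra.
  - intros x Hx eps He.
    assert (He' : 0 < eps / (a + b)) by (apply Rdiv_lt_0_compat; lra).
    destruct (fc x Hx _ He') as [d [Hd Hfd]].
    destruct (gc x Hx _ He') as [d' [Hd' Hgd]].
    exists (Rmin d d'). split; [now apply Rmin_pos|].
    intros y Hy Hyx.
    specialize (Hfd y Hy (Rlt_le_trans _ _ _ Hyx (Rmin_l _ _))).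
    specialize (Hgd y Hy (Rlt_le_trans _ _ _ Hyx (Rmin_r _ _))).
    replace eps with (a * (eps / (a + b)) + b * (eps / (a + b))) by (field; lra).
    apply Rabs_def2 in Hfd. apply Rabs_def2 in Hgd.
    destruct (Rle_lt_or_eq_dec 0 a Ha) as [Ha'|<-]; apply Rabs_def1; nra.
Qed.

Lemma Kfun_id : Kfun (fun x => x).
Proof.
  split; [reflexivity|]. split; [trivial|].
  intros x _ eps He. exists eps. auto.
Qed.

Lemma Kfun_id_add (rho : R -> R) : Kfun rho -> Kfun (fun x => x + rho x).
Proof.
  intros H. pose proof (Kfun_conic _ _ 1 1 Kfun_id H ltac:(lra) ltac:(lra) ltac:(lra)) as K.
  destruct K as [K0 [K1 K2]]. split; [lra|]. split.
  - intros x y Hx Hy. specialize (K1 x y Hx Hy). lra.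
  - intros x Hx eps He. destruct (K2 x Hx eps He) as [d [Hd Hdd]].
    exists d. split; [assumption|]. intros y Hy Hyx. specialize (Hdd y Hy Hyx).
    now rewrite !Rmult_1_l in Hdd.
Qed.

Lemma Kfun_half (rho : R -> R) : Kfun rho -> Kfun (fun x => rho x / 2).
Proof.
  intros [H0 [Hi Hc]]. split; [rewrite H0; lra|]. split.
  - intros x y Hx Hxy. specialize (Hi x y Hx Hxy). lra.
  - intros x Hx eps He. destruct (Hc x Hx eps He) as [d [Hd Hdd]].
    exists d. split; [assumption|]. intros y Hy Hyx.
    specialize (Hdd y Hy Hyx). apply Rabs_def2 in Hdd. apply Rabs_def1; lra.
Qed.

Lemma Kinf_half (rho : R -> R) : Kinf rho -> Kinf (fun x => rho x / 2).
Proof.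
  intros [H Hu]. split; [now apply Kfun_half|].
  intros C. destruct (Hu (2 * C)) as [x [Hx Hxx]]. exists x. split; lra.
Qed.

(** By left continuity, [g m > C] would keep [g] above [C] just to the left of [m], making [m - d]
    an upper bound of [E]. This moves estimates from the points of a set to its supremum. *)
Lemma Kfun_sup_le (g : R -> R) (E : R -> Prop) (m C : R) :
  Kfun g -> is_lub E m -> (exists x, E x) -> (forall x, E x -> 0 <= x /\ g x <= C) ->
  g m <= C.
Proof.
  intros Hg [Hub Hlub] [x0 Hx0] HE.
  assert (Hm : 0 <= m) by (apply Rle_trans with x0; [apply HE, Hx0 | apply Hub, Hx0]).
  apply Rnot_lt_le. intros Hlt.
  destruct (proj2 (proj2 Hg) m Hm (g m - C) ltac:(lra)) as [d [Hd Hdd]].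
  apply (Rlt_irrefl m). apply Rle_lt_trans with (m - d); [|lra].
  apply Hlub. intros x Hx. apply Rnot_lt_le. intros Hxd.
  destruct (HE x Hx) as [Hx1 Hx2]. specialize (Hub x Hx).
  specialize (Hdd x Hx1). rewrite Rabs_left1 in Hdd by lra.
  specialize (Hdd ltac:(lra)). apply Rabs_def2 in Hdd. lra.
Qed.

Lemma Kinf_surj (g : R -> R) (y : R) : Kinf g -> 0 <= y -> exists x, 0 <= x /\ g x = y.
Proof.
  intros [Hg Hu] Hy. pose proof Hg as [g0 [gi gc]].
  set (E := fun x => 0 <= x /\ g x <= y).
  assert (HE0 : E 0) by (split; lra).
  destruct (Hu y) as [B [HB HyB]].
  destruct (completeness E) as [m Hm].
  - exists B. intros x [Hx Hxy]. apply Rnot_lt_le. intros Hlt.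
    specialize (gi B x HB Hlt). lra.
  - exists 0. assumption.
  - assert (Hm0 : 0 <= m) by (apply Hm, HE0).
    exists m. split; [assumption|]. apply Rle_antisym.
    + apply (Kfun_sup_le g E); trivial. now exists 0.
    + apply Rnot_lt_le. intros Hlt.
      destruct (gc m Hm0 (y - g m) ltac:(lra)) as [d [Hd Hdd]].
      (* If [g m < y], continuity puts [m + d / 2] into [E], beyond its supremum. *)
      specialize (Hdd (m + d / 2) ltac:(lra)). rewrite Rabs_pos_eq in Hdd by lra.
      specialize (Hdd ltac:(lra)). apply Rabs_def2 in Hdd.
      assert (m + d / 2 <= m); [|lra].
      apply Hm. split; lra.
Qed.

Lemma Kinf_inverse (g : R -> R) :
  Kinf g -> exists h, Kfun h /\ forall y, 0 <= y -> 0 <= h y /\ g (h y) = y.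
Proof.
  intros Hg.
  destruct (functional_choice (fun y x => 0 <= y -> 0 <= x /\ g x = y)) as [h Hh].
  { intros y. destruct (Rle_dec 0 y) as [Hy|Hy]; [|exists 0; tauto].
    destruct (Kinf_surj g y Hg Hy) as [x Hx]. now exists x. }
  exists h. split; [|assumption].
  destruct Hg as [Hg _].
  assert (Hlt : forall x y, 0 <= x -> 0 <= y -> g x < y -> x < h y).
  { intros x y Hx Hy Hxy. destruct (Hh y Hy) as [H1 H2]. apply Rnot_le_lt. intros Hle.
    pose proof (Kfun_le g _ _ Hg H1 Hle). lra. }
  assert (Hgt : forall x y, 0 <= x -> 0 <= y -> y < g x -> h y < x).
  { intros x y Hx Hy Hxy. destruct (Hh y Hy) as [H1 H2]. apply Rnot_le_lt. intros Hle.
    pose proof (Kfun_le g _ _ Hg Hx Hle). lra. }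
  split; [|split].
  - destruct (Hh 0 (Rle_refl 0)) as [H1 H2].
    destruct H1 as [H1|H1]; [|now symmetry]. pose proof (Kfun_pos _ _ Hg H1). lra.
  - intros x y Hx Hxy. destruct (Hh x Hx) as [H1 H2]. apply Hlt; lra.
  - intros x Hx eps He. destruct (Hh x Hx) as [H1 H2].
    pose proof (proj1 (proj2 Hg) (h x) (h x + eps) H1 ltac:(lra)) as Hup.
    (* When [h x < eps], the point [h x - eps] leaves the half-line, but there [h x - eps < h y]
       follows from [0 <= h y]. *)
    destruct (Rle_dec eps (h x)) as [Hex|Hex].
    + pose proof (proj1 (proj2 Hg) (h x - eps) (h x) ltac:(lra) ltac:(lra)) as Hdn.
      exists (Rmin (g (h x + eps) - x) (x - g (h x - eps))).
      split; [apply Rmin_pos; lra|].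
      intros y Hy Hyx.
      pose proof (Rmin_l (g (h x + eps) - x) (x - g (h x - eps))).
      pose proof (Rmin_r (g (h x + eps) - x) (x - g (h x - eps))).
      apply Rabs_def2 in Hyx.
      pose proof (Hlt (h x - eps) y ltac:(lra) Hy ltac:(lra)).
      pose proof (Hgt (h x + eps) y ltac:(lra) Hy ltac:(lra)).
      apply Rabs_def1; lra.
    + exists (g (h x + eps) - x). split; [lra|].
      intros y Hy Hyx. apply Rabs_def2 in Hyx.
      pose proof (Hgt (h x + eps) y ltac:(lra) Hy ltac:(lra)).
      pose proof (proj1 (Hh y Hy)).
      apply Rabs_def1; lra.
Qed.

(** * Suprema and Lipschitz minorants *)

(** The same expression as in [snorm], so that facts about [supR] apply to the norm by
    conversion. *)
Definition supR (E : R -> Prop) : R := real (Lub_Rbar E).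

Lemma supR_is_lub (E : R -> Prop) (B : R) :
  (exists x, E x) -> (forall x, E x -> x <= B) -> is_lub E (supR E).
Proof.
  intros HE HB.
  destruct (completeness E) as [m Hm]; [now exists B | assumption |].
  unfold supR. rewrite (is_lub_Rbar_unique E (Finite m)); [assumption|].
  destruct Hm as [H1 H2]. split.
  - intros x Hx. apply H1, Hx.
  - intros [b| |] Hb; simpl; trivial.
    + apply H2. intros x Hx. apply (Hb x Hx).
    + destruct HE as [x Hx]. exact (Hb x Hx).
Qed.

(* The infimal convolution of [D] with the absolute value. *)
Lemma lipschitz_minorant (D : R -> R) :
  D 0 = 0 -> (forall x, 0 <= x -> 0 <= D x) ->
  (forall a b, 0 < a -> a <= b -> exists c, 0 < c /\ forall x, a <= x <= b -> c <= D x) ->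
  exists F : R -> R, F 0 = 0 /\
    (forall a b, 0 < a -> a <= b -> exists c, 0 < c /\ forall x, a <= x <= b -> c <= F x) /\
    (forall x, 0 <= x -> F x <= D x) /\
    (forall x y, 0 <= x -> 0 <= y -> Rabs (F x - F y) <= Rabs (x - y)).
Proof.
  intros D0 Dpos Dloc.
  (* Values are negated, so that the infimum is [- supR (E r)]. *)
  set (E := fun r y => exists x, 0 <= x /\ y = - (D x + Rabs (x - r))).
  assert (HE : forall r, is_lub (E r) (supR (E r))).
  { intros r. apply supR_is_lub with 0.
    - exists (- (D 0 + Rabs (0 - r))). exists 0. split; [lra | reflexivity].
    - intros y [x [Hx ->]]. pose proof (Dpos x Hx). pose proof (Rabs_pos (x - r)). lra. }
  set (F := fun r => - supR (E r)).
  assert (Flb : forall r x, 0 <= x -> F r <= D x + Rabs (x - r)).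
  { intros r x Hx. destruct (HE r) as [H _]. unfold F.
    specialize (H (- (D x + Rabs (x - r)))).
    assert (- (D x + Rabs (x - r)) <= supR (E r)); [|lra].
    apply H. now exists x. }
  assert (Fglb : forall r C, (forall x, 0 <= x -> C <= D x + Rabs (x - r)) -> C <= F r).
  { intros r C HC. destruct (HE r) as [_ H]. unfold F.
    assert (supR (E r) <= - C); [|lra].
    apply H. intros y [x [Hx ->]]. specialize (HC x Hx). lra. }
  assert (Flip : forall x y, F x - F y <= Rabs (x - y)).
  { intros x y. assert (F x - Rabs (x - y) <= F y); [|lra].
    apply Fglb. intros z Hz. pose proof (Flb x z Hz).
    pose proof (Rabs_triang (z - y) (y - x)).
    replace (z - y + (y - x)) with (z - x) in H0 by ring.
    rewrite (Rabs_minus_sym y x) in H0. lra. }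
  assert (FD : forall x, 0 <= x -> F x <= D x).
  { intros x Hx. pose proof (Flb x x Hx). rewrite Rminus_diag, Rabs_R0 in H. lra. }
  exists F. repeat split.
  - apply Rle_antisym; [pose proof (FD 0 (Rle_refl 0)); lra|].
    apply Fglb. intros x Hx. pose proof (Dpos x Hx). pose proof (Rabs_pos (x - 0)). lra.
  (* Points outside [[a / 2, b + a / 2]] are at distance at least [a / 2] from [r]; on that interval
     [D] is at least [c]. *)
  - intros a b Ha Hab. destruct (Dloc (a / 2) (b + a / 2) ltac:(lra) ltac:(lra)) as [c [Hc Hcc]].
    exists (Rmin c (a / 2)). split; [apply Rmin_pos; lra|].
    intros r Hr. apply Fglb. intros x Hx. pose proof (Dpos x Hx).
    pose proof (Rmin_l c (a / 2)). pose proof (Rmin_r c (a / 2)).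
    pose proof (Rle_abs (x - r)). pose proof (Rle_abs (r - x)).
    rewrite Rabs_minus_sym in H3. pose proof (Rabs_pos (x - r)).
    destruct (Rlt_dec x (a / 2)); [lra|].
    destruct (Rlt_dec (b + a / 2) x); [lra|].
    specialize (Hcc x ltac:(lra)). lra.
  - assumption.
  - intros x y _ _. pose proof (Flip x y). pose proof (Flip y x).
    rewrite (Rabs_minus_sym y x) in H0. apply Rabs_le. lra.
Qed.

(** * Linear interpolation *)

Definition lin_interp (q : Z -> R) (t : R) : R :=
  q (Int_part t) + (t - IZR (Int_part t)) * (q (Int_part t + 1)%Z - q (Int_part t)).

Lemma Int_part_le (z : Z) (t : R) : IZR z <= t -> (z <= Int_part t)%Z.
Proof.
  intros H. destruct (base_Int_part t) as [_ H2].
  apply Z.lt_succ_r, lt_IZR. rewrite succ_IZR. lra.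
Qed.

Lemma Int_part_ge (z : Z) (t : R) : t <= IZR z -> (Int_part t <= z)%Z.
Proof. intros H. destruct (base_Int_part t) as [H1 _]. apply le_IZR. lra. Qed.

Lemma interp_IZR (q : Z -> R) (z : Z) : lin_interp q (IZR z) = q z.
Proof.
  unfold lin_interp. rewrite <- (Int_part_spec (IZR z) z) by lra. ring.
Qed.

Lemma interp_opp (q : Z -> R) (t : R) : lin_interp (fun m => - q m) t = - lin_interp q t.
Proof. unfold lin_interp. ring. Qed.

Lemma interp_weight (t : R) : 0 <= t - IZR (Int_part t) <= 1.
Proof. destruct (base_Int_part t). lra. Qed.

Lemma interp_bounds (q : Z -> R) (t a b : R) :
  a <= q (Int_part t) <= b -> a <= q (Int_part t + 1)%Z <= b -> a <= lin_interp q t <= b.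
Proof. unfold lin_interp. pose proof (interp_weight t). nra. Qed.

Lemma interp_le_compat (q q' : Z -> R) (t : R) :
  (forall m, q m <= q' m) -> lin_interp q t <= lin_interp q' t.
Proof.
  intros H. unfold lin_interp. pose proof (interp_weight t).
  pose proof (H (Int_part t)). pose proof (H (Int_part t + 1)%Z). nra.
Qed.

Lemma slope_iter (q : Z -> R) (d : R) (lo hi : Z) (k : nat) :
  (forall m, (lo <= m <= hi)%Z -> d <= q (m + 1)%Z - q m) ->
  (lo + Z.of_nat k <= hi + 1)%Z ->
  d * INR k <= q (lo + Z.of_nat k)%Z - q lo.
Proof.
  intros H. induction k as [|k IH]; intros Hk.
  - simpl. rewrite Z.add_0_r. lra.
  - rewrite S_INR. specialize (IH ltac:(lia)).
    specialize (H (lo + Z.of_nat k)%Z ltac:(lia)).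
    replace (lo + Z.of_nat (S k))%Z with (lo + Z.of_nat k + 1)%Z by lia. lra.
Qed.

Lemma interp_slope_ge (q : Z -> R) (d : R) (lo hi : Z) (t1 t2 : R) :
  (forall m, (lo <= m <= hi)%Z -> d <= q (m + 1)%Z - q m) ->
  IZR lo <= t1 -> t1 <= t2 -> t2 <= IZR hi ->
  d * (t2 - t1) <= lin_interp q t2 - lin_interp q t1.
Proof.
  intros H H1 H12 H2. unfold lin_interp.
  pose proof (interp_weight t1) as W1. pose proof (interp_weight t2) as W2.
  pose proof (Int_part_le _ _ H1) as L1. pose proof (Int_part_ge _ _ H2) as L2.
  assert (L12 : (Int_part t1 <= Int_part t2)%Z).
  { apply Int_part_le. destruct (base_Int_part t1). lra. }
  set (n1 := Int_part t1) in *. set (n2 := Int_part t2) in *.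
  (* [n2 = hi] occurs when [t2 = IZR hi], so the slope bound is used at index [hi] too. *)
  pose proof (H n1 ltac:(lia)) as S1. pose proof (H n2 ltac:(lia)) as S2.
  (* Unless both points share a cell, [[t1, t2]] is cut at [n1 + 1] and [n2] into two partial cells
     and the whole cells between them. *)
  destruct (Z.eq_dec n1 n2) as [<-|Hne]; [nra|].
  pose proof (slope_iter q d (n1 + 1) hi (Z.to_nat (n2 - (n1 + 1)))
                ltac:(intros; apply H; lia) ltac:(lia)) as S3.
  rewrite INR_IZR_INZ, Z2Nat.id in S3 by lia.
  replace (n1 + 1 + (n2 - (n1 + 1)))%Z with n2 in S3 by lia.
  rewrite minus_IZR, plus_IZR in S3.
  nra.
Qed.

Lemma interp_slope_le (q : Z -> R) (B : R) (lo hi : Z) (t1 t2 : R) :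
  (forall m, (lo <= m <= hi)%Z -> q (m + 1)%Z - q m <= B) ->
  IZR lo <= t1 -> t1 <= t2 -> t2 <= IZR hi ->
  lin_interp q t2 - lin_interp q t1 <= B * (t2 - t1).
Proof.
  intros H H1 H12 H2.
  pose proof (interp_slope_ge (fun m => - q m) (- B) lo hi t1 t2) as K.
  rewrite !interp_opp in K. cut (- B * (t2 - t1) <= - lin_interp q t2 - - lin_interp q t1); [lra|].
  apply K; trivial. intros m Hm. specialize (H m Hm). lra.
Qed.

(** Finitely many positive constants have a positive minimum, and [P] survives lowering the constant
    to it. *)
Lemma Zrange_uniform (P : Z -> R -> Prop) (n : Z) :
  (forall m, exists c, 0 < c /\ P m c) ->
  (forall m c c', 0 < c' -> c' <= c -> P m c -> P m c') ->
  exists c, 0 < c /\ forall m, (- n <= m <= n)%Z -> P m c.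
Proof.
  intros H1 H2.
  assert (K : forall k : nat, exists c, 0 < c /\
             forall m, (- n <= m < - n + Z.of_nat k)%Z -> P m c).
  { induction k as [|k [c [Hc IH]]].
    - exists 1. split; [lra|]. intros m Hm. lia.
    - destruct (H1 (- n + Z.of_nat k)%Z) as [c' [Hc' HP]].
      exists (Rmin c c'). pose proof (Rmin_pos c c' Hc Hc') as Hp. split; [assumption|].
      intros m Hm. destruct (Z.eq_dec m (- n + Z.of_nat k)) as [->|Hne].
      + apply (H2 _ c'); trivial. apply Rmin_r.
      + apply (H2 _ c); trivial; [apply Rmin_l|]. apply IH. lia. }
  destruct (K (Z.to_nat (2 * n + 1))) as [c [Hc HP]].
  exists c. split; [assumption|]. intros m Hm. apply HP. lia.
Qed.

Lemma IZR_above (x : R) : exists m : Z, (0 <= m)%Z /\ x <= IZR m.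
Proof.
  destruct (INR_unbounded x) as [n Hn]. exists (Z.of_nat n).
  rewrite <- INR_IZR_INZ. split; [lia | lra].
Qed.

(* The substitution [r - 1 / r] maps the half-line onto the real line and is bi-Lipschitz
   on compacts. *)
Definition zpath (q : Z -> R) (r : R) : R :=
  if Rle_dec r 0 then 0 else lin_interp q (r - / r).

Lemma zpath_pos_eq (q : Z -> R) (r : R) : 0 < r -> zpath q r = lin_interp q (r - / r).
Proof. intros H. unfold zpath. destruct (Rle_dec r 0); [lra | reflexivity]. Qed.

Lemma zpath_0 (q : Z -> R) : zpath q 0 = 0.
Proof. unfold zpath. destruct (Rle_dec 0 0); [reflexivity | lra]. Qed.

Lemma zpath_le_compat (q q' : Z -> R) (r : R) :
  (forall m, q m <= q' m) -> zpath q r <= zpath q' r.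
Proof.
  intros H. unfold zpath. destruct (Rle_dec r 0); [lra | now apply interp_le_compat].
Qed.

Lemma zpath_param_bilip (a x1 x2 : R) :
  0 < a -> a <= x1 -> x1 <= x2 ->
  x2 - x1 <= (x2 - / x2) - (x1 - / x1) <= (1 + / (a * a)) * (x2 - x1).
Proof.
  intros Ha H1 H12.
  assert (E : (x2 - / x2) - (x1 - / x1) = (1 + / (x1 * x2)) * (x2 - x1)) by (field; lra).
  rewrite E.
  assert (0 < / (x1 * x2)) by (apply Rinv_0_lt_compat; nra).
  assert (/ (x1 * x2) <= / (a * a)) by (apply Rinv_le_contravar; nra).
  nra.
Qed.

Lemma zpath_window (a b : R) :
  0 < a -> exists n : Z, forall x, a <= x <= b -> IZR (- n) <= x - / x <= IZR n.
Proof.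
  intros Ha. destruct (IZR_above (b + / a)) as [n [_ Hn]].
  exists n. intros x Hx. rewrite opp_IZR.
  assert (0 < / x) by (apply Rinv_0_lt_compat; lra).
  assert (/ x <= / a) by (apply Rinv_le_contravar; lra).
  assert (0 < b) by lra. lra.
Qed.

Lemma zpath_bilip (q : Z -> R) (a b d B x1 x2 : R) (n : Z) :
  0 < a -> (forall x, a <= x <= b -> IZR (- n) <= x - / x <= IZR n) ->
  0 <= d -> 0 <= B -> (forall m, (- n <= m <= n)%Z -> d <= q (m + 1)%Z - q m <= B) ->
  a <= x1 -> x1 <= x2 -> x2 <= b ->
  d * (x2 - x1) <= zpath q x2 - zpath q x1 <= B * (1 + / (a * a)) * (x2 - x1).
Proof.
  intros Ha Hn Hd HB Hq H1 H12 H2.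
  rewrite !zpath_pos_eq by lra.
  pose proof (zpath_param_bilip a x1 x2 Ha H1 H12) as [P1 P2].
  pose proof (Hn x1 ltac:(lra)) as N1. pose proof (Hn x2 ltac:(lra)) as N2.
  pose proof (interp_slope_ge q d (- n) n (x1 - / x1) (x2 - / x2)) as G.
  pose proof (interp_slope_le q B (- n) n (x1 - / x1) (x2 - / x2)) as L.
  specialize (G ltac:(intros; now apply Hq) ltac:(lra) ltac:(lra) ltac:(lra)).
  specialize (L ltac:(intros; now apply Hq) ltac:(lra) ltac:(lra) ltac:(lra)).
  split; [|rewrite Rmult_assoc]; nra.
Qed.

(** On compacts of the open half-line, finitely many increments control the slopes from both sides.
    The behaviour of [q] at the two ends of the integers gives continuity at [0] and
    unboundedness. *)
Lemma zpath_Kinf (q : Z -> R) :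
  (forall m, 0 < q m) -> (forall m, q m < q (m + 1)%Z) ->
  (forall eps, 0 < eps -> exists m, q m < eps) ->
  (forall C, exists m, C < q m) -> Kinf (zpath q).
Proof.
  intros Hpos Hinc Hsm Hlg.
  assert (Hmono : forall t1 t2, t1 <= t2 -> lin_interp q t1 <= lin_interp q t2).
  { intros t1 t2 H12.
    destruct (IZR_above (Rabs t1)) as [n1 [_ Hn1]]. destruct (IZR_above t2) as [n2 [_ Hn2]].
    pose proof (interp_slope_ge q 0 (- n1) n2 t1 t2) as K.
    assert (0 * (t2 - t1) <= lin_interp q t2 - lin_interp q t1); [|lra].
    apply K; trivial.
    - intros m _. specialize (Hinc m). lra.
    - rewrite opp_IZR. pose proof (Rle_abs (- t1)). rewrite Rabs_Ropp in H. lra. }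
  assert (Hloc : forall a b, 0 < a -> exists d B, 0 < d /\ 0 < B /\
            forall x1 x2, a <= x1 -> x1 <= x2 -> x2 <= b ->
              d * (x2 - x1) <= zpath q x2 - zpath q x1 <= B * (x2 - x1)).
  { intros a b Ha. destruct (zpath_window a b Ha) as [n Hn].
    (* Using [c] below and [/ c] above makes the property monotone in a single constant. *)
    destruct (Zrange_uniform (fun m c => c <= q (m + 1)%Z - q m <= / c) n) as [c [Hc HP]].
    - intros m. specialize (Hinc m). set (D := q (m + 1)%Z - q m).
      assert (HD : 0 < D) by (unfold D; lra).
      exists (Rmin D (/ D)). pose proof (Rinv_0_lt_compat _ HD) as HD'.
      pose proof (Rmin_pos _ _ HD HD') as Hp.
      split; [assumption|]. split; [apply Rmin_l|].
      rewrite <- (Rinv_inv D) at 1. apply Rinv_le_contravar; trivial. apply Rmin_r.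
    - intros m c c' Hc' Hcc [P1 P2]. split; [lra|].
      apply Rle_trans with (/ c); [assumption|]. apply Rinv_le_contravar; lra.
    - pose proof (Rinv_0_lt_compat _ Hc).
      assert (0 < / (a * a)) by (apply Rinv_0_lt_compat; nra).
      exists c, (/ c * (1 + / (a * a))). split; [assumption|]. split; [nra|].
      intros x1 x2 H1 H12 H2. apply (zpath_bilip q a b c (/ c) x1 x2 n); trivial; lra. }
  split; [split; [apply zpath_0|split]|].
  - intros x y Hx Hxy. destruct Hx as [Hx|<-].
    + destruct (Hloc x y Hx) as [d [B [Hd [HB H]]]].
      destruct (H x y ltac:(lra) ltac:(lra) ltac:(lra)) as [H1 _]. nra.
    + rewrite zpath_0, zpath_pos_eq by lra.
      set (t := y - / y). pose proof (Hinc (Int_part t)).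
      pose proof (interp_bounds q t (q (Int_part t)) (q (Int_part t + 1)%Z)).
      specialize (Hpos (Int_part t)). lra.
  - intros x Hx eps He. destruct Hx as [Hx|<-].
    + destruct (Hloc (x / 2) (2 * x) ltac:(lra)) as [d [B [Hd [HB H]]]].
      exists (Rmin (x / 2) (eps / B)). split.
      { apply Rmin_pos; [lra|]. apply Rdiv_lt_0_compat; lra. }
      intros y Hy Hyx. pose proof (Rmin_l (x / 2) (eps / B)).
      pose proof (Rmin_r (x / 2) (eps / B)). apply Rabs_def2 in Hyx.
      assert (EB : B * (eps / B) = eps) by (field; lra).
      destruct (Rle_dec x y) as [Hle|Hle].
      * destruct (H x y) as [K1 K2]; try lra. apply Rabs_def1; nra.
      * destruct (H y x) as [K1 K2]; try lra. apply Rabs_def1; nra.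
    + destruct (Hsm eps He) as [m Hm].
      destruct (IZR_above (- IZR m)) as [n [Hn0 Hn]].
      assert (Hn' : 0 <= IZR n) by now apply IZR_le.
      (* Below this point [y < 1] and [/ y > n + 1], so the parameter [y - / y] is less than
         [- n <= m]. *)
      exists (/ (IZR n + 1)). split; [apply Rinv_0_lt_compat; lra|].
      intros y Hy Hyx. rewrite Rminus_0_r in Hyx. rewrite Rabs_pos_eq in Hyx by lra.
      rewrite zpath_0, Rminus_0_r.
      destruct Hy as [Hy|<-]; [|rewrite zpath_0, Rabs_R0; assumption].
      rewrite zpath_pos_eq by lra.
      assert (IZR n + 1 < / y).
      { rewrite <- (Rinv_inv (IZR n + 1)). apply Rinv_lt_contravar; [|assumption].
        apply Rmult_lt_0_compat; [assumption|]. apply Rinv_0_lt_compat; lra. }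
      assert (y < 1).
      { apply Rlt_le_trans with (1 := Hyx). rewrite <- Rinv_1. apply Rinv_le_contravar; lra. }
      assert (lin_interp q (y - / y) <= q m).
      { rewrite <- (interp_IZR q m). apply Hmono. lra. }
      set (t := y - / y) in *. pose proof (Hinc (Int_part t)).
      pose proof (interp_bounds q t (q (Int_part t)) (q (Int_part t + 1)%Z)).
      specialize (Hpos (Int_part t)). rewrite Rabs_pos_eq; lra.
  - intros C. destruct (Hlg C) as [m Hm].
    destruct (IZR_above (IZR m)) as [n [Hn0 Hn]].
    assert (Hn' : 0 <= IZR n) by now apply IZR_le.
    exists (IZR n + 1). split; [lra|]. rewrite zpath_pos_eq by lra.
    apply Rlt_le_trans with (1 := Hm). rewrite <- (interp_IZR q m) at 1. apply Hmono.
    assert (/ (IZR n + 1) <= 1); [|lra].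
    rewrite <- Rinv_1 at 2. apply Rinv_le_contravar; lra.
Qed.

(** * The supremum norm and max-type operators *)

Lemma snorm_is_lub (I : Type) (i0 : I) (s : I -> R) :
  linf_plus s -> is_lub (fun x => exists i, x = Rabs (s i)) (snorm s).
Proof.
  intros [_ [B HB]]. apply supR_is_lub with B.
  - now exists (Rabs (s i0)), i0.
  - intros x [i ->]. apply HB.
Qed.

Lemma le_snorm (I : Type) (s : I -> R) (i : I) : linf_plus s -> s i <= snorm s.
Proof.
  intros Hs. apply Rle_trans with (1 := Rle_abs _).
  apply (snorm_is_lub I i s Hs). now exists i.
Qed.

Lemma linf_plus_of_bounds (I : Type) (s : I -> R) (C : R) :
  (forall i, 0 <= s i <= C) -> linf_plus s.
Proof.
  intros H. split; [apply H|]. exists C. intros i. rewrite Rabs_pos_eq; apply H.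
Qed.

Lemma snorm_le (I : Type) (i0 : I) (s : I -> R) (C : R) :
  (forall i, 0 <= s i <= C) -> snorm s <= C.
Proof.
  intros H. apply (snorm_is_lub I i0 s (linf_plus_of_bounds I s C H)).
  intros x [i ->]. rewrite Rabs_pos_eq; apply H.
Qed.

Lemma snorm_nonneg (I : Type) (i0 : I) (s : I -> R) : linf_plus s -> 0 <= snorm s.
Proof. intros Hs. apply Rle_trans with (s i0); [apply Hs | now apply le_snorm]. Qed.

Lemma snorm_const (I : Type) (i0 : I) (x : R) : 0 <= x -> snorm (fun _ : I => x) = x.
Proof.
  intros Hx. apply Rle_antisym.
  - apply (snorm_le I i0). intros _. lra.
  - apply (le_snorm I (fun _ => x) i0). apply linf_plus_of_bounds with x. intros _. lra.
Qed.

Lemma fold_Rmax_ge (A : Type) (f : A -> R) (l : list A) :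
  0 <= fold_right Rmax 0 (map f l) /\
  forall a, In a l -> f a <= fold_right Rmax 0 (map f l).
Proof.
  induction l as [|b l [IH0 IH]]; simpl; [split; [lra | tauto]|]. split.
  - apply Rle_trans with (1 := IH0). apply Rmax_r.
  - intros a [->|Ha]; [apply Rmax_l|]. apply Rle_trans with (1 := IH a Ha). apply Rmax_r.
Qed.

Lemma fold_Rmax_attained (A : Type) (f : A -> R) (l : list A) :
  fold_right Rmax 0 (map f l) = 0 \/
  exists a, In a l /\ fold_right Rmax 0 (map f l) = f a.
Proof.
  induction l as [|b l IH]; simpl; [now left|].
  unfold Rmax at 1 3. destruct (Rle_dec (f b) (fold_right Rmax 0 (map f l))).
  - destruct IH as [IH|[a [Ha IH]]]; [now left|]. right. exists a. auto.
  - right. exists b. auto.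
Qed.

Lemma Gam_nonneg (I : Type) (Ii : I -> list I) (gam : I -> I -> R -> R) (s : I -> R) (i : I) :
  0 <= Gam Ii gam s i.
Proof. apply fold_Rmax_ge. Qed.

Lemma Gam_ge (I : Type) (Ii : I -> list I) (gam : I -> I -> R -> R) (s : I -> R) (i j : I) :
  In j (Ii i) -> gam i j (s j) <= Gam Ii gam s i.
Proof. apply (fold_Rmax_ge I (fun j => gam i j (s j)) (Ii i)). Qed.

Lemma Gam_attained (I : Type) (Ii : I -> list I) (gam : I -> I -> R -> R) (s : I -> R) (i : I) :
  Gam Ii gam s i = 0 \/ exists j, In j (Ii i) /\ Gam Ii gam s i = gam i j (s j).
Proof. apply (fold_Rmax_attained I (fun j => gam i j (s j)) (Ii i)). Qed.

Lemma Gam_mono (I : Type) (Ii : I -> list I) (gam : I -> I -> R -> R) (s u : I -> R) (i : I) :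
  max_type_gain Ii gam -> (forall j, 0 <= s j <= u j) -> Gam Ii gam s i <= Gam Ii gam u i.
Proof.
  intros [_ [HK _]] H. destruct (Gam_attained I Ii gam s i) as [->|[j [Hj ->]]].
  - apply Gam_nonneg.
  - apply Rle_trans with (2 := Gam_ge I Ii gam u i j Hj).
    apply Kfun_le; [apply HK, Hj | apply H | apply H].
Qed.

(** Equicontinuity is only pointwise, so a common bound is carried from [0] to [b] by continuous
    induction: a supremum [m < b] of the points having one could be exceeded. *)
Lemma gain_edge_bound (I : Type) (Ii : I -> list I) (gam : I -> I -> R -> R) (b : R) :
  max_type_gain Ii gam -> 0 <= b ->
  exists C, forall i j, In j (Ii i) -> gam i j b <= C.
Proof.
  intros [_ [HK Heq]] Hb.
  set (E := fun x => 0 <= x <= b /\ exists C, forall i j, In j (Ii i) -> gam i j x <= C).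
  assert (E0 : E 0).
  { split; [lra|]. exists 0. intros i j Hij. rewrite (proj1 (proj1 (HK i j Hij))). lra. }
  destruct (completeness E) as [m [Hub Hlub]].
  { exists b. intros x [Hx _]. lra. }
  { now exists 0. }
  assert (Hm : 0 <= m) by apply Hub, E0.
  assert (Hmb : m <= b) by (apply Hlub; intros x [Hx _]; lra).
  destruct (Heq m Hm 1 ltac:(lra)) as [d [Hd Hdd]].
  assert (HEx : exists x, E x /\ m - d < x).
  { apply NNPP. intros Hn. assert (m <= m - d); [|lra].
    apply Hlub. intros x Hx. apply Rnot_lt_le. intros Hlt. apply Hn. now exists x. }
  destruct HEx as [x [[Hx [C HC]] Hxm]].
  assert (Hxm' : x <= m) by (apply Hub; split; [assumption | now exists C]).
  assert (HE : E (Rmin b (m + d))).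
  { pose proof (Rmin_l b (m + d)). pose proof (Rmin_r b (m + d)).
    assert (m <= Rmin b (m + d)) by (apply Rmin_glb; lra).
    (* The comparison goes from [x] to the new point through [m], at a cost of [1] for each of the
       two moves. *)
    split; [lra|]. exists (C + 2). intros i j Hij.
    pose proof (Hdd i j Hij x ltac:(lra) ltac:(apply Rabs_le; lra)) as D1.
    pose proof (Hdd i j Hij (Rmin b (m + d)) ltac:(lra) ltac:(apply Rabs_le; lra)) as D2.
    apply Rabs_le_between in D1. apply Rabs_le_between in D2.
    specialize (HC i j Hij). lra. }
  pose proof (Hub _ HE) as Hle.
  assert (Hbm : Rmin b (m + d) = b).
  { unfold Rmin in *. destruct (Rle_dec b (m + d)); [reflexivity | lra]. }
  rewrite Hbm in HE. apply HE.
Qed.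

Lemma Gam_rho_nonneg (I : Type) (Ii : I -> list I) (gam : I -> I -> R -> R) (rho : R -> R)
  (s : I -> R) (i : I) : Kfun rho -> 0 <= Gam_rho Ii gam rho s i.
Proof.
  intros Hr. pose proof (Gam_nonneg I Ii gam s i).
  pose proof (Kfun_nonneg rho _ Hr H). unfold Gam_rho. lra.
Qed.

Lemma Gam_rho_ge (I : Type) (Ii : I -> list I) (gam : I -> I -> R -> R) (rho : R -> R)
  (s : I -> R) (i j : I) :
  max_type_gain Ii gam -> Kfun rho -> In j (Ii i) -> 0 <= s j ->
  gam i j (s j) + rho (gam i j (s j)) <= Gam_rho Ii gam rho s i.
Proof.
  intros Hg Hr Hj Hs. pose proof (Gam_ge I Ii gam s i j Hj).
  apply (Kfun_le _ _ _ (Kfun_id_add rho Hr)); [|assumption].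
  apply Kfun_nonneg; [apply Hg, Hj | assumption].
Qed.

Lemma Gam_rho_attained (I : Type) (Ii : I -> list I) (gam : I -> I -> R -> R) (rho : R -> R)
  (s : I -> R) (i : I) : Kfun rho ->
  Gam_rho Ii gam rho s i = 0 \/
  exists j, In j (Ii i) /\ Gam_rho Ii gam rho s i = gam i j (s j) + rho (gam i j (s j)).
Proof.
  intros Hr. unfold Gam_rho. destruct (Gam_attained I Ii gam s i) as [->|[j [Hj ->]]].
  - left. rewrite (proj1 Hr). ring.
  - right. now exists j.
Qed.

Lemma Gam_rho_mono (I : Type) (Ii : I -> list I) (gam : I -> I -> R -> R) (rho : R -> R)
  (s u : I -> R) (i : I) :
  max_type_gain Ii gam -> Kfun rho -> (forall j, 0 <= s j <= u j) ->
  Gam_rho Ii gam rho s i <= Gam_rho Ii gam rho u i.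
Proof.
  intros Hg Hr H. apply (Kfun_le _ _ _ (Kfun_id_add rho Hr)).
  - apply Gam_nonneg.
  - now apply Gam_mono.
Qed.

Lemma Gam_rho_0 (I : Type) (Ii : I -> list I) (gam : I -> I -> R -> R) (rho : R -> R)
  (s : I -> R) (i : I) :
  max_type_gain Ii gam -> Kfun rho -> (forall j, s j = 0) -> Gam_rho Ii gam rho s i = 0.
Proof.
  intros Hg Hr Hs. destruct (Gam_rho_attained I Ii gam rho s i Hr) as [H|[j [Hj ->]]]; trivial.
  rewrite Hs. assert (HK : Kfun (gam i j)) by apply Hg, Hj.
  rewrite (proj1 HK), (proj1 Hr). ring.
Qed.

Lemma Gam_rho_linf (I : Type) (Ii : I -> list I) (gam : I -> I -> R -> R) (rho : R -> R)
  (s : I -> R) :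
  max_type_gain Ii gam -> Kfun rho -> linf_plus s -> linf_plus (Gam_rho Ii gam rho s).
Proof.
  intros Hg Hr Hs.
  assert (Hs0 : forall i, 0 <= s i <= Rmax 0 (snorm s)).
  { intros i. split; [apply Hs|].
    apply Rle_trans with (2 := Rmax_r _ _). now apply le_snorm. }
  destruct (gain_edge_bound I Ii gam (Rmax 0 (snorm s)) Hg (Rmax_l _ _)) as [C HC].
  apply linf_plus_of_bounds with (Rmax 0 (C + rho C)). intros i.
  split; [now apply Gam_rho_nonneg|].
  destruct (Gam_rho_attained I Ii gam rho s i Hr) as [->|[j [Hj ->]]]; [apply Rmax_l|].
  apply Rle_trans with (2 := Rmax_r _ _).
  assert (HK : Kfun (gam i j)) by apply Hg, Hj.
  apply (Kfun_le _ _ _ (Kfun_id_add rho Hr)).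
  - apply Kfun_nonneg; [assumption | apply Hs].
  - apply Rle_trans with (2 := HC i j Hj). apply Kfun_le; trivial; apply Hs0.
Qed.

(** Equicontinuity at [0], where all gains vanish, makes [d] common to all edges. *)
Lemma gain_edge_small (I : Type) (Ii : I -> list I) (gam : I -> I -> R -> R) (rho : R -> R)
  (eps : R) :
  max_type_gain Ii gam -> Kfun rho -> 0 < eps ->
  exists d, 0 < d /\ forall i j, In j (Ii i) -> gam i j d + rho (gam i j d) < eps.
Proof.
  intros [_ [HK Heq]] Hr He.
  destruct (Kfun_small _ eps (Kfun_id_add rho Hr) He) as [c [Hc Hce]].
  destruct (Heq 0 (Rle_refl 0) c Hc) as [d [Hd Hdd]].
  exists d. split; [assumption|]. intros i j Hij.
  assert (HKij : Kfun (gam i j)) by apply HK, Hij.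
  specialize (Hdd i j Hij d ltac:(lra)). rewrite Rminus_0_r in Hdd.
  rewrite (Rabs_pos_eq d) in Hdd by lra. specialize (Hdd (Rle_refl d)).
  rewrite (proj1 HKij), Rminus_0_r in Hdd.
  apply Rle_lt_trans with (2 := Hce).
  apply (Kfun_le _ _ _ (Kfun_id_add rho Hr)).
  - apply Kfun_nonneg; trivial; lra.
  - apply Rle_trans with (2 := Hdd), Rle_abs.
Qed.

(** * Trajectories and uniform attractivity *)

Lemma iter_linf (I : Type) (Ii : I -> list I) (gam : I -> I -> R -> R) (rho : R -> R)
  (s : I -> R) (n : nat) :
  max_type_gain Ii gam -> Kfun rho -> linf_plus s ->
  linf_plus (Nat.iter n (Gam_rho Ii gam rho) s).
Proof.
  intros Hg Hr Hs. induction n as [|n IH]; [assumption|]. simpl. now apply Gam_rho_linf.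
Qed.

Lemma iter_mono (I : Type) (Ii : I -> list I) (gam : I -> I -> R -> R) (rho : R -> R)
  (s u : I -> R) (n : nat) :
  max_type_gain Ii gam -> Kfun rho -> (forall j, 0 <= s j <= u j) ->
  forall i, 0 <= Nat.iter n (Gam_rho Ii gam rho) s i <= Nat.iter n (Gam_rho Ii gam rho) u i.
Proof.
  intros Hg Hr Hs. induction n as [|n IH]; [assumption|]. intros i. simpl. split.
  - now apply Gam_rho_nonneg.
  - now apply Gam_rho_mono.
Qed.

(** Constant states suffice: the operators are monotone, and a state of norm at most [x] lies below
    the constant [x]. *)
Definition uniformly_attractive (I : Type) (T : (I -> R) -> (I -> R)) : Prop :=
  forall x eps, 0 < x -> 0 < eps -> exists N : nat,
    forall n, (N <= n)%nat -> forall i, Nat.iter n T (fun _ => x) i <= eps.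

Lemma UGAS_attractive (I : Type) (i0 : I) (Ii : I -> list I) (gam : I -> I -> R -> R)
  (rho : R -> R) :
  max_type_gain Ii gam -> Kfun rho ->
  UGAS (Gam_rho Ii gam rho) -> uniformly_attractive I (Gam_rho Ii gam rho).
Proof.
  intros Hg Hr [beta [[_ [_ Hb]] HU]] x eps Hx He.
  destruct (proj2 (Hb x Hx) eps He) as [T [HT HTe]].
  destruct (INR_unbounded T) as [N HN]. exists N. intros n Hn i.
  assert (Hlin : linf_plus (fun _ : I => x)) by (apply linf_plus_of_bounds with x; intros _; lra).
  apply Rle_trans with (1 := le_snorm I _ i (iter_linf I Ii gam rho _ n Hg Hr Hlin)).
  apply Rle_trans with (1 := HU _ Hlin n). rewrite (snorm_const I i0) by lra.
  apply le_INR in Hn. specialize (HTe (INR n) ltac:(lra)).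
  apply Rabs_def2 in HTe. lra.
Qed.

Lemma UGAS_bounded (I : Type) (i0 : I) (T : (I -> R) -> (I -> R)) :
  UGAS T -> trajectories_bounded T.
Proof.
  intros [beta [[_ [HK Hb]] HU]] s Hs. exists (beta (snorm s) 0). intros n.
  apply Rle_trans with (1 := HU s Hs n). pose proof (pos_INR n) as Hn.
  destruct (snorm_nonneg I i0 s Hs) as [Hp|<-].
  - destruct Hn as [Hn|<-]; [|lra]. apply Rlt_le, (Hb _ Hp); lra.
  - rewrite (proj1 (HK _ Hn)), (proj1 (HK 0 (Rle_refl 0))). lra.
Qed.

(** * The uniform NJI condition *)

Lemma in_nbhd_refl (I : Type) (Ii : I -> list I) (n : nat) (i : I) : in_nbhd Ii n i i.
Proof. induction n as [|n IH]; simpl; auto. Qed.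

(* The maximum defining [T_i] is attained at some in-neighbour, so a failure of NJI
   around [i] propagates backwards along a path of length [n]. *)
Lemma no_decrease_propagates (I : Type) (Ii : I -> list I) (gam : I -> I -> R -> R)
  (rho : R -> R) (n : nat) :
  max_type_gain Ii gam -> Kfun rho ->
  forall eps, 0 < eps -> exists delta, 0 < delta /\
    forall s i, linf_plus s -> eps <= s i ->
      (forall j, in_nbhd Ii n j i -> delta <= s j -> s j <= Gam_rho Ii gam rho s j) ->
      s i <= Nat.iter n (Gam_rho Ii gam rho) s i.
Proof.
  intros Hg Hr. induction n as [|n IH]; intros eps He.
  { exists 1. split; [lra|]. intros s i _ _ _. simpl. lra. }
  destruct (gain_edge_small I Ii gam rho eps Hg Hr He) as [e1 [He1 Hsm]].
  destruct (IH e1 He1) as [d [Hd HIH]].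
  (* Below [d] for the recursion at the in-neighbour, below [eps] so that the hypothesis applies at
     [i] itself. *)
  exists (Rmin d eps). pose proof (Rmin_pos d eps Hd He) as Hp. split; [assumption|].
  intros s i Hs Hsi Hall.
  assert (H1 : s i <= Gam_rho Ii gam rho s i).
  { apply Hall; [apply in_nbhd_refl|]. apply Rle_trans with (2 := Hsi), Rmin_r. }
  destruct (Gam_rho_attained I Ii gam rho s i Hr) as [H0|[j [Hj Hatt]]]; [lra|].
  assert (HK : Kfun (fun x => gam i j x + rho (gam i j x))).
  { apply (Kfun_comp (fun x => x + rho x) (gam i j)); [now apply Kfun_id_add | apply Hg, Hj]. }
  (* Otherwise the perturbed gain along this edge would be below [eps], although it equals
     [T_i s >= s i >= eps]. *)
  assert (Hj1 : e1 <= s j).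
  { apply Rnot_lt_le. intros Hlt. specialize (Hsm i j Hj).
    pose proof (Kfun_le _ _ _ HK (proj1 Hs j) (Rlt_le _ _ Hlt)). simpl in H. lra. }
  assert (H2 : s j <= Nat.iter n (Gam_rho Ii gam rho) s j).
  { apply HIH; trivial. intros k Hk Hdk. apply Hall.
    - simpl. right. now exists j.
    - apply Rle_trans with (2 := Hdk), Rmin_l. }
  apply Rle_trans with (1 := H1). rewrite Hatt. simpl.
  apply Rle_trans with (2 := Gam_rho_ge I Ii gam rho _ i j Hg Hr Hj
           (proj1 (iter_linf I Ii gam rho s n Hg Hr Hs) j)).
  apply (Kfun_le _ _ _ HK); [apply Hs | assumption].
Qed.

Lemma attractive_uniform_NJI (I : Type) (Ii : I -> list I) (gam : I -> I -> R -> R)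
  (rho : R -> R) :
  max_type_gain Ii gam -> Kfun rho ->
  uniformly_attractive I (Gam_rho Ii gam rho) -> uniform_NJI Ii (Gam_rho Ii gam rho).
Proof.
  intros Hg Hr Hatt r eps Hpr He.
  destruct (Hatt r (eps / 2) Hpr ltac:(lra)) as [N HN].
  destruct (no_decrease_propagates I Ii gam rho N Hg Hr eps He) as [d [Hd Hprop]].
  exists N, d. split; [assumption|]. intros s i Hs Hsi Hsr. apply NNPP. intros Hno.
  assert (H1 : s i <= Nat.iter N (Gam_rho Ii gam rho) s i).
  { apply Hprop; trivial. intros j Hj Hdj. apply Rnot_lt_le. intros Hlt.
    apply Hno. now exists j. }
  assert (H2 : forall j, 0 <= s j <= r).
  { intros j. split; [apply Hs|]. apply Rle_trans with (2 := Hsr). now apply le_snorm. }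
  pose proof (iter_mono I Ii gam rho s (fun _ => r) N Hg Hr H2 i).
  specialize (HN N (Nat.le_refl N) i). lra.
Qed.

(** Vertices may be repeated; the estimates use only membership and the length. *)
Fixpoint nbhd_list (I : Type) (Ii : I -> list I) (n : nat) (i : I) : list I :=
  match n with
  | O => i :: nil
  | S m => nbhd_list I Ii m i ++ flat_map (nbhd_list I Ii m) (Ii i)
  end%list.

Lemma in_nbhd_list (I : Type) (Ii : I -> list I) (n : nat) (i j : I) :
  in_nbhd Ii n j i -> In j (nbhd_list I Ii n i).
Proof.
  revert i. induction n as [|n IH]; simpl; intros i.
  - intros ->. now left.
  - intros [H|[k [Hk H]]]; apply in_or_app; [left; auto|].
    right. apply in_flat_map. exists k. auto.
Qed.

Lemma nbhd_list_length (I : Type) (Ii : I -> list I) (M n : nat) (i : I) :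
  (forall i, (length (Ii i) <= M)%nat) -> (length (nbhd_list I Ii n i) <= (1 + M) ^ n)%nat.
Proof.
  intros HM. revert i. induction n as [|n IH]; intros i; [simpl; lia|].
  cbn [nbhd_list]. rewrite length_app, Nat.pow_succ_r'.
  assert (H : forall l : list I,
    (length (flat_map (nbhd_list I Ii n) l) <= length l * (1 + M) ^ n)%nat).
  { induction l as [|k l IHl]; [simpl; lia|]. cbn [flat_map length].
    rewrite length_app. specialize (IH k). nia. }
  specialize (H (Ii i)). specialize (HM i). specialize (IH i). nia.
Qed.

Definition lsum (I : Type) (s : I -> R) (l : list I) : R := fold_right Rplus 0 (map s l).

Lemma lsum_bounds (I : Type) (s : I -> R) (C : R) (l : list I) :
  (forall i, 0 <= s i <= C) -> 0 <= lsum I s l <= C * INR (length l).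
Proof.
  intros H. induction l as [|i l IH]; unfold lsum in *; simpl map; simpl fold_right.
  - simpl. lra.
  - cbn [length]. rewrite S_INR. specialize (H i). lra.
Qed.

Lemma lsum_le (I : Type) (s u : I -> R) (l : list I) :
  (forall i, u i <= s i) -> lsum I u l <= lsum I s l.
Proof.
  intros H. induction l as [|i l IH]; unfold lsum in *; simpl; [lra|].
  specialize (H i). lra.
Qed.

Lemma lsum_drop (I : Type) (s u : I -> R) (theta : R) (l : list I) (j : I) :
  (forall i, u i <= s i) -> In j l -> u j < s j - theta -> lsum I u l < lsum I s l - theta.
Proof.
  intros H. induction l as [|i l IH]; simpl; [tauto|]. unfold lsum in *. simpl.
  pose proof (H i) as Hi. intros [->|Hj] Hth.
  - pose proof (lsum_le I s u l H) as K. unfold lsum in K. lra.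
  - specialize (IH Hj Hth). lra.
Qed.

(* The sum of the entries over [l] starts below [C * length l], so it cannot drop by more
   than [theta] at each of the first [N] steps. *)
Lemma almost_stationary_time (I : Type) (u : nat -> I -> R) (C theta : R) (l : list I) (N : nat) :
  (forall n i, 0 <= u n i <= C) -> (forall n i, u (S n) i <= u n i) ->
  C * INR (length l) < theta * INR N ->
  exists k, (k < N)%nat /\ forall j, In j l -> u k j - theta <= u (S k) j.
Proof.
  intros Hb Hd HN. apply NNPP. intros Hno.
  assert (K : forall k, (k <= N)%nat -> lsum I (u k) l <= lsum I (u 0%nat) l - theta * INR k).
  { induction k as [|k IH]; intros Hk; [simpl; lra|].
    assert (Hj : exists j, In j l /\ u (S k) j < u k j - theta).
    { apply NNPP. intros Hn. apply Hno. exists k. split; [lia|]. intros j Hj.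
      apply Rnot_lt_le. intros Hlt. apply Hn. now exists j. }
    destruct Hj as [j [Hj Hlt]].
    pose proof (lsum_drop I (u k) (u (S k)) theta l j (Hd k) Hj Hlt).
    specialize (IH ltac:(lia)). rewrite S_INR. lra. }
  specialize (K N (Nat.le_refl N)).
  pose proof (lsum_bounds I (u 0%nat) C l (Hb 0%nat)).
  pose proof (lsum_bounds I (u N) C l (Hb N)). lra.
Qed.

(** A max-type operator passes through suprema: its value at [p] is a single continuous increasing
    gain at a single [p j], so bounding that gain on [E j] is enough. *)
Lemma Gam_rho_sup_le (I : Type) (Ii : I -> list I) (gam : I -> I -> R -> R) (rho : R -> R)
  (E : I -> R -> Prop) (p : I -> R) (i : I) (C : R) :
  max_type_gain Ii gam -> Kfun rho ->
  (forall j, is_lub (E j) (p j)) -> (forall j, exists y, E j y) ->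
  (forall j y, E j y -> 0 <= y) -> 0 <= C ->
  (forall j y, In j (Ii i) -> E j y -> gam i j y + rho (gam i j y) <= C) ->
  Gam_rho Ii gam rho p i <= C.
Proof.
  intros Hg Hr Hlub Hne Hpos HC H.
  destruct (Gam_rho_attained I Ii gam rho p i Hr) as [->|[j [Hj ->]]]; [assumption|].
  apply (Kfun_sup_le (fun x => gam i j x + rho (gam i j x)) (E j)).
  - apply (Kfun_comp (fun x => x + rho x) (gam i j)); [now apply Kfun_id_add | apply Hg, Hj].
  - apply Hlub.
  - apply Hne.
  - intros y Hy. split; [now apply (Hpos j) | now apply H].
Qed.

Lemma NJI_attractive (I : Type) (Ii : I -> list I) (gam : I -> I -> R -> R)
  (rho : R -> R) (M : nat) :
  max_type_gain Ii gam -> Kinf rho -> (forall i, (length (Ii i) <= M)%nat) ->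
  trajectories_bounded (Gam_rho Ii gam rho) -> uniform_NJI Ii (Gam_rho Ii gam rho) ->
  uniformly_attractive I (Gam_rho Ii gam (fun x => rho x / 2)).
Proof.
  intros Hg Hrinf HM Htb HNJI x eps Hx He.
  pose proof (proj1 Hrinf) as Hr. pose proof (proj1 (Kinf_half rho Hrinf)) as Hr'.
  set (T := Gam_rho Ii gam rho) in *. set (rho' := fun x => rho x / 2) in *.
  set (T' := Gam_rho Ii gam rho').
  assert (Hlin : linf_plus (fun _ : I => x)) by (apply linf_plus_of_bounds with x; intros _; lra).
  destruct (Htb _ Hlin) as [C0 HC0].
  set (C := Rmax C0 x).
  assert (HCx : x <= C) by apply Rmax_r.
  assert (Horb : forall n i, 0 <= Nat.iter n T (fun _ => x) i <= C).
  { intros n i. pose proof (iter_linf I Ii gam rho _ n Hg Hr Hlin) as L. split; [apply L|].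
    apply Rle_trans with (1 := le_snorm I _ i L). apply Rle_trans with (1 := HC0 n), Rmax_l. }
  set (E := fun i y => exists n, y = Nat.iter n T (fun _ => x) i).
  assert (Hlub : forall i, is_lub (E i) (supR (E i))).
  { intros i. apply supR_is_lub with C.
    - now exists x, 0%nat.
    - intros y [n ->]. apply Horb. }
  set (s := fun i => supR (E i)).
  assert (Hs : forall i, x <= s i <= C).
  { intros i. destruct (Hlub i) as [H1 H2]. split.
    - apply H1. now exists 0%nat.
    - apply H2. intros y [n ->]. apply Horb. }
  (* Applying [T] to the supremum of the orbit amounts to shifting the orbit by one step. *)
  assert (HTs : forall i, T s i <= s i).
  { intros i. apply (Gam_rho_sup_le I Ii gam rho E); trivial.
    - intros j. now exists x, 0%nat.
    - intros j y [n ->]. apply Horb.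
    - specialize (Hs i). lra.
    - intros j y Hj [n ->].
      apply Rle_trans with (Nat.iter (S n) T (fun _ => x) i).
      + apply (Gam_rho_ge I Ii gam rho _ i j Hg Hr Hj), Horb.
      + apply (Hlub i). now exists (S n). }
  set (u := fun n => Nat.iter n T' s).
  assert (HTT : forall v i, T v i = T' v i + rho (Gam Ii gam v i) / 2).
  { intros v i. unfold T, T', Gam_rho, rho'. lra. }
  assert (Hu0 : forall n i, 0 <= u n i).
  { intros n i. destruct n; simpl; [specialize (Hs i); unfold u; simpl; lra|].
    now apply Gam_rho_nonneg. }
  assert (Hdec : forall n i, u (S n) i <= u n i).
  { induction n as [|n IH]; intros i.
    - apply Rle_trans with (2 := HTs i). unfold u. simpl. rewrite HTT.
      pose proof (Kfun_nonneg rho _ Hr (Gam_nonneg I Ii gam s i)). lra.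
    - apply Gam_rho_mono; trivial. intros j. exact (conj (Hu0 (S n) j) (IH j)). }
  assert (Hdec' : forall n k i, u (n + k)%nat i <= u n i).
  { intros n k i. induction k as [|k IH]; [rewrite Nat.add_0_r; lra|].
    rewrite Nat.add_succ_r. apply Rle_trans with (2 := IH), Hdec. }
  assert (HuC : forall n i, 0 <= u n i <= C).
  { intros n i. split; [apply Hu0|]. apply Rle_trans with (1 := Hdec' 0%nat n i), Hs. }
  destruct (HNJI C eps ltac:(lra) He) as [n [delta [Hdel HN]]].
  (* [y0] is chosen so that a state [u] with [Gam u j <= y0] has [T' u j < delta / 2]. *)
  destruct (Kfun_small _ (delta / 2) (Kfun_id_add rho' Hr') ltac:(lra)) as [y0 [Hy0 Hy0d]].
  pose proof (Kfun_pos rho y0 Hr Hy0) as Hry.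
  (* The first bound leaves [u j - theta >= delta / 2] when [u j >= delta]; the second lets the
     missing term [rho (Gam u j) / 2 >= rho y0 / 2] exceed [theta]. *)
  set (theta := Rmin (delta / 2) (rho y0 / 4)).
  assert (Hth : 0 < theta) by (apply Rmin_pos; lra).
  (* Drops of [theta] at each of [N] steps would use up more than the largest possible sum over a
     neighbourhood, whichever vertex it surrounds. *)
  destruct (INR_unbounded (C * INR ((1 + M) ^ n) / theta)) as [N HNN].
  assert (HNN' : C * INR ((1 + M) ^ n) < theta * INR N).
  { replace (C * INR ((1 + M) ^ n)) with (theta * (C * INR ((1 + M) ^ n) / theta)) by (field; lra).
    apply Rmult_lt_compat_l; assumption. }
  exists N. intros m Hm i. apply Rle_trans with (u m i).
  { apply iter_mono; trivial. intros j. specialize (Hs j). lra. }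
  apply Rnot_lt_le. intros Hbig.
  destruct (almost_stationary_time I u C theta (nbhd_list I Ii n i) N HuC Hdec) as [k [Hk Hst]].
  { apply Rle_lt_trans with (2 := HNN'). apply Rmult_le_compat_l; [lra|].
    apply le_INR, nbhd_list_length, HM. }
  assert (Hki : eps <= u k i).
  { replace m with (k + (m - k))%nat in Hbig by lia. specialize (Hdec' k (m - k)%nat i). lra. }
  destruct (HN (u k) i) as [j [Hj [Hdj Hlt]]]; trivial.
  { apply linf_plus_of_bounds with C. apply HuC. }
  { apply (snorm_le I i). apply HuC. }
  specialize (Hst j (in_nbhd_list I Ii n i j Hj)).
  change (u (S k) j) with (T' (u k) j) in Hst. rewrite HTT in Hlt.
  assert (Hth1 : theta <= delta / 2) by apply Rmin_l.
  assert (Hth2 : theta <= rho y0 / 4) by apply Rmin_r.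
  (* A smaller value would give [T' (u k) j < delta / 2], against almost stationarity at [j]. *)
  assert (Hy : y0 <= Gam Ii gam (u k) j).
  { apply Rnot_lt_le. intros Hy.
    pose proof (Kfun_le _ _ _ (Kfun_id_add rho' Hr') (Gam_nonneg I Ii gam (u k) j)
                  (Rlt_le _ _ Hy)) as K.
    simpl in K. change (T' (u k) j <= y0 + rho' y0) in K. lra. }
  pose proof (Kfun_le rho _ _ Hr (Rlt_le _ _ Hy0) Hy). lra.
Qed.

(** * Construction of a path of strict decay *)

(* Level [m] of the sequence is the supremum of the states [T^n (x 1)] over all pairs [(x, n)]
   with [admissible T x (m + n)]. The first clause delays large [x] until their trajectory
   has dropped below [1 / x], which keeps every level bounded. The second lets [x -> 0] in
   when [m -> -oo], which keeps every level positive. The condition depends on [m + n] only,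
   so [T] maps level [m + 1] below level [m]. *)
Definition admissible (I : Type) (T : (I -> R) -> (I -> R)) (x c : R) : Prop :=
  (exists N : nat, x <= INR N /\
     (forall n, (N <= n)%nat -> forall j, Nat.iter n T (fun _ => x) j <= / x) /\
     2 * INR N <= c) \/
  (x <= 1 /\ - / x <= c).

Lemma attractive_sequence (I : Type) (Ii : I -> list I) (gam : I -> I -> R -> R) (rho : R -> R) :
  max_type_gain Ii gam -> Kfun rho -> uniformly_attractive I (Gam_rho Ii gam rho) ->
  exists p : Z -> I -> R,
    (forall m i, p m i <= p (m + 1)%Z i) /\
    (forall m i, Gam_rho Ii gam rho (p (m + 1)%Z) i <= p m i) /\
    (forall m, exists a b, 0 < a /\ forall i, a <= p m i <= b) /\
    (forall eps, 0 < eps -> exists m, forall i, p m i <= eps) /\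
    (forall C, exists m, forall i, C <= p m i).
Proof.
  intros Hg Hr Hatt. set (T := Gam_rho Ii gam rho) in *.
  set (orb := fun n x => Nat.iter n T (fun _ : I => x)).
  assert (Hlin : forall x, 0 < x -> linf_plus (fun _ : I => x)).
  { intros x Hx. apply linf_plus_of_bounds with x. intros _. lra. }
  assert (Hmono : forall n x y i, 0 < x -> x <= y -> 0 <= orb n x i <= orb n y i).
  { intros n x y i Hx Hxy. apply iter_mono; trivial. intros _. lra. }
  (* After time [N] the orbit is below [1]; the finitely many earlier states are bounded one by
     one. *)
  assert (Hbd : forall x, 0 < x -> exists C, forall n i, orb n x i <= C).
  { intros x Hx. destruct (Hatt x 1 Hx ltac:(lra)) as [N HN].
    assert (K : forall k, exists C, forall n, (n < k)%nat -> forall i, orb n x i <= C).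
    { induction k as [|k [C HC]]; [exists 0; intros; lia|].
      pose proof (iter_linf I Ii gam rho _ k Hg Hr (Hlin x Hx)) as L.
      exists (Rmax C (snorm (orb k x))). intros n Hn i.
      destruct (Nat.eq_dec n k) as [->|Hne].
      - apply Rle_trans with (2 := Rmax_r _ _). now apply le_snorm.
      - apply Rle_trans with (2 := Rmax_l _ _). apply HC. lia. }
    destruct (K N) as [C HC]. exists (Rmax C 1). intros n i.
    destruct (Nat.lt_ge_cases n N) as [Hn|Hn].
    - apply Rle_trans with (2 := Rmax_l _ _). now apply HC.
    - apply Rle_trans with (2 := Rmax_r _ _). now apply HN. }
  (* Uniform stability: smallness of the gains near [0] handles the first [N] steps, comparison with
     the orbit of [1] handles the rest. *)
  assert (Hstab : forall eps, 0 < eps -> exists d, 0 < d /\ forall n i, orb n d i <= eps).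
  { intros eps He. destruct (Hatt 1 eps ltac:(lra) He) as [N HN].
    assert (K : forall k e, 0 < e ->
              exists d, 0 < d /\ d <= 1 /\ forall n, (n < k)%nat -> forall i, orb n d i <= e).
    { induction k as [|k IH]; intros e Hee; [exists 1; repeat split; try lra; intros; lia|].
      destruct (gain_edge_small I Ii gam rho e Hg Hr Hee) as [c [Hc Hce]].
      destruct (IH (Rmin c e) (Rmin_pos _ _ Hc Hee)) as [d [Hd [Hd1 Hdd]]].
      exists (Rmin d e). pose proof (Rmin_pos _ _ Hd Hee) as Hp.
      pose proof (Rmin_l d e) as Hl. pose proof (Rmin_r d e) as Hl'.
      repeat split; try lra. intros n Hn i. destruct n as [|n]; [exact Hl'|].
      change (T (orb n (Rmin d e)) i <= e).
      destruct (Gam_rho_attained I Ii gam rho (orb n (Rmin d e)) i Hr) as [H0|[j [Hj H0]]];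
        unfold T; rewrite H0; [lra|].
      apply Rlt_le, Rle_lt_trans with (2 := Hce i j Hj).
      assert (HK : Kfun (gam i j)) by apply Hg, Hj.
      apply (Kfun_le _ _ _ (Kfun_comp _ _ (Kfun_id_add rho Hr) HK)).
      - apply (Hmono n _ d); trivial.
      - apply Rle_trans with (1 := proj2 (Hmono n _ d j Hp Hl)).
        apply Rle_trans with (2 := Rmin_l c e). apply Hdd. lia. }
    destruct (K N eps He) as [d [Hd [Hd1 Hdd]]]. exists d. split; [assumption|].
    intros n i. destruct (Nat.lt_ge_cases n N) as [Hn|Hn]; [now apply Hdd|].
    apply Rle_trans with (1 := proj2 (Hmono n d 1 i Hd Hd1)). now apply HN. }
  set (E := fun m i y => exists x n, 0 < x /\ admissible I T x (IZR m + INR n) /\ y = orb n x i).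
  assert (Hin : forall m, exists x, 0 < x /\ forall i, E m i x).
  { intros m. destruct (IZR_above (- IZR m)) as [k [Hk0 Hk]].
    apply IZR_le in Hk0.
    assert (Hk1 : 0 < / (IZR k + 1)) by (apply Rinv_0_lt_compat; lra).
    exists (/ (IZR k + 1)). split; [assumption|].
    intros i. exists (/ (IZR k + 1)), 0%nat. split; [assumption|]. split; [|reflexivity].
    right. rewrite Rinv_inv. simpl. split; [|lra].
    rewrite <- Rinv_1. apply Rinv_le_contravar; lra. }
  (* A start [x <= |m| + 1] stays below the orbit of [|m| + 1]. A larger one enters only by the
     first clause, and [2 * N <= m + n] with [m < x <= N] forces [n >= N], hence a value at most
     [/ x <= 1]. *)
  assert (Hup : forall m, exists b, forall i y, E m i y -> y <= b).
  { intros m. pose proof (Rabs_pos (IZR m)) as Hm0. pose proof (Rle_abs (IZR m)) as Hm1.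
    destruct (Hbd (Rabs (IZR m) + 1) ltac:(lra)) as [C HC].
    exists (Rmax C 1). intros i y [x [n [Hx [Hadm ->]]]].
    destruct (Rle_dec x (Rabs (IZR m) + 1)) as [Hle|Hgt].
    - apply Rle_trans with (2 := Rmax_l _ _).
      apply Rle_trans with (1 := proj2 (Hmono n x _ i Hx Hle)), HC.
    - apply Rle_trans with (2 := Rmax_r _ _).
      destruct Hadm as [[N [HxN [HN HNc]]]|[Hx1 _]]; [|lra].
      apply Rle_trans with (/ x).
      + apply HN. apply INR_le. lra.
      + rewrite <- Rinv_1. apply Rinv_le_contravar; lra. }
  assert (Hlub : forall m i, is_lub (E m i) (supR (E m i))).
  { intros m i. destruct (Hup m) as [b Hb]. apply supR_is_lub with b; [|apply Hb].
    destruct (Hin m) as [x [_ Hxi]]. exists x. apply Hxi. }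
  exists (fun m i => supR (E m i)). repeat split.
  - intros m i. apply (Hlub m i). intros y [x [n [Hx [Hadm ->]]]]. apply (Hlub (m + 1)%Z i).
    exists x, n. split; [assumption|]. split; [|reflexivity]. rewrite plus_IZR.
    destruct Hadm as [[N [H1 [H2 H3]]]|[H1 H2]]; [left; exists N | right];
      repeat split; trivial; lra.
  - intros m i. apply (Gam_rho_sup_le I Ii gam rho (E (m + 1)%Z)); trivial.
    + intros j. destruct (Hin (m + 1)%Z) as [x [_ Hxi]]. exists x. apply Hxi.
    + intros j y [x [n [Hx [_ ->]]]]. apply (Hmono n x x); lra.
    + destruct (Hin m) as [x [Hx Hxi]]. apply Rle_trans with x; [lra|]. apply (Hlub m i), Hxi.
    + intros j y Hj [x [n [Hx [Hadm ->]]]].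
      apply Rle_trans with (orb (S n) x i).
      * apply (Gam_rho_ge I Ii gam rho _ i j Hg Hr Hj). apply (Hmono n x x); lra.
      * apply (Hlub m i). exists x, (S n). split; [assumption|]. split; [|reflexivity].
        rewrite S_INR. rewrite plus_IZR in Hadm.
        replace (IZR m + (INR n + 1)) with (IZR m + 1 + INR n) by ring. assumption.
  - intros m. destruct (Hin m) as [a [Ha Hai]]. destruct (Hup m) as [b Hb].
    exists a, b. split; [assumption|]. intros i. split.
    + apply (Hlub m i), Hai.
    + apply (Hlub m i). intros y. apply Hb.
  - intros eps He.
    assert (He' : 0 < / eps) by now apply Rinv_0_lt_compat.
    destruct (Hatt (1 + / eps) eps ltac:(lra) He) as [N1 HN1].
    destruct (Hstab eps He) as [d [Hd Hdd]].
    assert (Hd' : 0 < / d) by now apply Rinv_0_lt_compat.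
    pose proof (pos_INR N1) as HN1'.
    (* At level [- k], starts [x >= 1 + / eps] have already dropped below [/ x <= eps], and smaller
       ones are below [eps] from time [N1] on. Before [N1] only the second clause can hold, and it
       forces [x <= d]. *)
    destruct (IZR_above (INR N1 + / d)) as [k [Hk0 Hk]].
    exists (- k)%Z. intros i. apply (Hlub (- k)%Z i). intros y [x [n [Hx [Hadm ->]]]].
    rewrite opp_IZR in Hadm. pose proof (pos_INR n) as Hn'.
    destruct (Rle_dec (1 + / eps) x) as [Hbig|Hsmall].
    + destruct Hadm as [[N [HxN [HN HNc]]]|[Hx1 _]]; [|lra].
      apply Rle_trans with (/ x).
      * apply HN, INR_le. pose proof (pos_INR N). lra.
      * rewrite <- (Rinv_inv eps). apply Rinv_le_contravar; lra.
    + destruct (Nat.lt_ge_cases n N1) as [Hn|Hn].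
      * apply lt_INR in Hn.
        destruct Hadm as [[N [HxN [HN HNc]]]|[Hx1 Hxc]]; [lra|].
        apply Rle_trans with (2 := Hdd n i). apply Hmono; [assumption|].
        rewrite <- (Rinv_inv x), <- (Rinv_inv d). apply Rinv_le_contravar; lra.
      * apply Rle_trans with (1 := proj2 (Hmono n x (1 + / eps) i Hx ltac:(lra))).
        now apply HN1.
  - intros C. set (x := Rmax C 1).
    assert (Hx1 : 1 <= x) by apply Rmax_r. assert (HxC : C <= x) by apply Rmax_l.
    destruct (Hatt x (/ x) ltac:(lra) ltac:(apply Rinv_0_lt_compat; lra)) as [N HN].
    destruct (INR_unbounded x) as [N' HN'].
    exists (2 * Z.of_nat (N + N'))%Z. intros i.
    apply Rle_trans with (1 := HxC). apply (Hlub _ i). exists x, 0%nat.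
    split; [lra|]. split; [|reflexivity]. left. exists (N + N')%nat. repeat split.
    + rewrite plus_INR. pose proof (pos_INR N). lra.
    + intros n Hn j. apply HN. lia.
    + rewrite mult_IZR, <- INR_IZR_INZ. simpl. lra.
Qed.

Lemma half_gain_decay (rho : R -> R) (x y : R) :
  Kfun rho -> 0 <= y -> y + rho y <= x ->
  y + rho y / 2 <= x - Rmin (rho (x / 2) / 2) (x / 4).
Proof.
  intros Hr Hy Hxy. pose proof (Kfun_nonneg rho y Hr Hy).
  pose proof (Rmin_l (rho (x / 2) / 2) (x / 4)). pose proof (Rmin_r (rho (x / 2) / 2) (x / 4)).
  destruct (Rle_dec (x / 2) y) as [Hle|Hgt]; [|lra].
  pose proof (Kfun_le rho (x / 2) y Hr ltac:(lra) Hle). lra.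
Qed.

Lemma half_gain_rate_mono (rho : R -> R) (a x : R) :
  Kfun rho -> 0 <= a -> a <= x ->
  Rmin (rho (a / 2) / 2) (a / 4) <= Rmin (rho (x / 2) / 2) (x / 4).
Proof.
  intros Hr Ha Hax. pose proof (Kfun_le rho (a / 2) (x / 2) Hr ltac:(lra) ltac:(lra)).

  apply Rmin_glb.
  - apply Rle_trans with (1 := Rmin_l _ _). lra.
  - apply Rle_trans with (1 := Rmin_r _ _). lra.
Qed.

Lemma half_gain_rate_pos (rho : R -> R) (x : R) :
  Kfun rho -> 0 < x -> 0 < Rmin (rho (x / 2) / 2) (x / 4).
Proof.
  intros Hr Hx. pose proof (Kfun_pos rho (x / 2) Hr ltac:(lra)). apply Rmin_pos; lra.
Qed.

(** The rate is replaced by a 1-Lipschitz minorant, so that subtracting a fraction of it from [x]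
    preserves order. *)
Lemma half_gain_lipschitz_rate (rho : R -> R) :
  Kfun rho -> exists alpha : R -> R,
    (forall a b, 0 < a -> a <= b -> exists c, 0 < c /\ forall x, a <= x <= b -> c <= alpha x) /\
    (forall x, 0 <= x -> 0 <= alpha x <= x / 4) /\
    (forall x y, 0 <= x -> x <= y -> alpha y - alpha x <= y - x) /\
    (forall x y, 0 <= y -> y + rho y <= x -> y + rho y / 2 <= x - alpha x).
Proof.
  intros Hr.
  destruct (lipschitz_minorant (fun x => Rmin (rho (x / 2) / 2) (x / 4))) as [F [F0 [F1 [F2 F3]]]].
  - replace (0 / 2) with 0 by lra. rewrite (proj1 Hr). unfold Rmin.
    destruct (Rle_dec (0 / 2) (0 / 4)); lra.
  - intros x [Hx|<-]; [now apply Rlt_le, half_gain_rate_pos|].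
    replace (0 / 2) with 0 by lra. rewrite (proj1 Hr). unfold Rmin.
    destruct (Rle_dec (0 / 2) (0 / 4)); lra.
  - intros a b Ha Hab. exists (Rmin (rho (a / 2) / 2) (a / 4)).
    split; [now apply half_gain_rate_pos|]. intros x Hx. apply half_gain_rate_mono; trivial; lra.
  - exists F. repeat split.
    + assumption.
    + destruct H as [Hx|<-]; [|lra]. destruct (F1 x x Hx (Rle_refl x)) as [c [Hc Hcx]].
      specialize (Hcx x ltac:(lra)). lra.
    + apply Rle_trans with (1 := F2 x H), Rmin_r.
    + intros x y Hx Hxy. specialize (F3 y x ltac:(lra) Hx).
      rewrite (Rabs_pos_eq (y - x)) in F3 by lra.
      apply Rle_trans with (2 := F3), Rle_abs.
    + intros x y Hy Hxy. apply Rle_trans with (1 := half_gain_decay rho x y Hr Hy Hxy).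
      pose proof (Kfun_nonneg rho y Hr Hy). specialize (F2 x ltac:(lra)). lra.
Qed.

(* Subtracting a decreasing fraction of the decay rate makes the sequence of
   [attractive_sequence] strictly increasing; half of [rho] pays for it. *)
Lemma strict_sequence (I : Type) (Ii : I -> list I) (gam : I -> I -> R -> R) (rho : R -> R) :
  max_type_gain Ii gam -> Kfun rho -> uniformly_attractive I (Gam_rho Ii gam rho) ->
  exists q : Z -> I -> R,
    (forall m, exists d, 0 < d /\ forall i, d <= q (m + 1)%Z i - q m i <= / d) /\
    (forall m i, Gam_rho Ii gam (fun x => rho x / 2) (q (m + 1)%Z) i <= q m i) /\
    (forall m, exists a b, 0 < a /\ forall i, a <= q m i <= b) /\
    (forall eps, 0 < eps -> exists m, forall i, q m i <= eps) /\
    (forall C, exists m, forall i, C <= q m i).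
Proof.
  intros Hg Hr Hatt.
  destruct (attractive_sequence I Ii gam rho Hg Hr Hatt) as [p [P1 [P2 [P3 [P4 P5]]]]].
  destruct (half_gain_lipschitz_rate rho Hr) as [alpha [A1 [A2 [A3 A4]]]].
  (* A strictly decreasing sequence over all the integers with values in [(0, 1)]. *)
  set (kappa := fun m => / 2 - atan (IZR m) / PI).
  pose proof PI_RGT_0 as Hpi.
  assert (Hk : forall m, 0 < kappa m < 1).
  { intros m. unfold kappa. destruct (atan_bound (IZR m)) as [B1 B2].
    assert (E : atan (IZR m) = atan (IZR m) / PI * PI) by (field; lra).
    set (z := atan (IZR m) / PI) in *. rewrite E in B1, B2. nra. }
  assert (Hkd : forall m, kappa (m + 1)%Z < kappa m).
  { intros m. unfold kappa.
    assert (atan (IZR m) / PI < atan (IZR (m + 1)) / PI); [|lra].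
    apply Rmult_lt_compat_r; [now apply Rinv_0_lt_compat|].
    apply atan_increasing. rewrite plus_IZR. lra. }
  set (q := fun m i => p m i - kappa m * alpha (p m i)).
  assert (Hp : forall m i, 0 < p m i).
  { intros m i. destruct (P3 m) as [a [b [Ha Hab]]]. specialize (Hab i). lra. }
  assert (Hqp : forall m i, p m i / 2 <= q m i <= p m i /\ p m i - alpha (p m i) <= q m i).
  { intros m i. unfold q. specialize (Hk m). specialize (Hp m i).
    specialize (A2 (p m i) ltac:(lra)). nra. }
  exists q. repeat split.
  - intros m.
    destruct (P3 m) as [a [b [Ha Hab]]]. destruct (P3 (m + 1)%Z) as [a' [b' [Ha' Hab']]].
    (* [Rmax a b] makes the interval nonempty without naming a vertex. *)
    destruct (A1 a (Rmax a b) Ha (Rmax_l _ _)) as [c [Hc Hcc]].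
    set (e := (kappa m - kappa (m + 1)%Z) * c).
    assert (He : 0 < e) by (apply Rmult_lt_0_compat; [specialize (Hkd m); lra | assumption]).
    set (B := Rmax b' 1).
    assert (HB1 : 1 <= B) by apply Rmax_r. assert (HBb : b' <= B) by apply Rmax_l.
    assert (HB : 0 < / B) by (apply Rinv_0_lt_compat; lra).
    exists (Rmin e (/ B)). pose proof (Rmin_pos _ _ He HB) as Hmin. split; [assumption|].
    intros i. split.
    (* With [alpha] 1-Lipschitz, the increment is at least [(1 - kappa (m + 1)) * (p (m + 1) i - p m
       i) + (kappa m - kappa (m + 1)) * alpha (p m i)]; the last term alone is at least [e]. *)
    + apply Rle_trans with (1 := Rmin_l _ _). unfold q, e.
      specialize (Hab i). pose proof (Hp m i) as Hpm. pose proof (P1 m i) as Hinc.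
      specialize (Hcc (p m i)). pose proof (Rmax_r a b). specialize (Hcc ltac:(lra)).
      specialize (A3 (p m i) (p (m + 1)%Z i) ltac:(lra) Hinc).
      specialize (Hkd m). pose proof (Hk (m + 1)%Z). pose proof (Hk m). nra.
    + apply Rle_trans with B.
      * pose proof (Hqp m i). pose proof (Hqp (m + 1)%Z i). specialize (Hp m i).
        specialize (Hab' i). lra.
      * rewrite <- (Rinv_inv B) at 1. apply Rinv_le_contravar; [assumption | apply Rmin_r].
  - intros m i. apply Rle_trans with (2 := proj2 (Hqp m i)).
    apply Rle_trans with (Gam_rho Ii gam (fun x => rho x / 2) (p (m + 1)%Z) i).
    + apply Gam_rho_mono; trivial; [now apply Kfun_half|].
      intros j. pose proof (Hqp (m + 1)%Z j). specialize (Hp (m + 1)%Z j). lra.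
    + apply A4; [apply Gam_nonneg | apply P2].
  - intros m. destruct (P3 m) as [a [b [Ha Hab]]]. exists (a / 2), b. split; [lra|].
    intros i. specialize (Hab i). pose proof (Hqp m i). lra.
  - intros eps He. destruct (P4 eps He) as [m Hm]. exists m. intros i.
    apply Rle_trans with (2 := Hm i), Hqp.
  - intros C. destruct (P5 (2 * C)) as [m Hm]. exists m. intros i.
    specialize (Hm i). pose proof (Hqp m i). lra.
Qed.

Lemma attractive_path (I : Type) (i0 : I) (Ii : I -> list I) (gam : I -> I -> R -> R)
  (rho : R -> R) :
  max_type_gain Ii gam -> Kinf rho -> uniformly_attractive I (Gam_rho Ii gam rho) ->
  exists sigma, path_strict_decay Ii gam sigma.
Proof.
  intros Hg Hrinf Hatt.
  pose proof (Kinf_half rho Hrinf) as Hr'inf. pose proof (proj1 Hr'inf) as Hr'.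
  destruct (strict_sequence I Ii gam rho Hg (proj1 Hrinf) Hatt) as [q [Q1 [Q2 [Q3 [Q4 Q5]]]]].
  set (rho' := fun x => rho x / 2) in *.
  (* Vertexwise suprema and infima at each level; their interpolations serve as [phimax] and
     [phimin]. *)
  set (up := fun m => supR (fun y => exists i, y = q m i)).
  set (lo := fun m => - supR (fun y => exists i, y = - q m i)).
  assert (Hup : forall m, is_lub (fun y => exists i, y = q m i) (up m)).
  { intros m. destruct (Q3 m) as [a [b [Ha Hab]]]. apply supR_is_lub with b.
    - now exists (q m i0), i0.
    - intros y [i ->]. apply Hab. }
  assert (Hlo : forall m, is_lub (fun y => exists i, y = - q m i) (- lo m)).
  { intros m. destruct (Q3 m) as [a [b [Ha Hab]]]. unfold lo. rewrite Ropp_involutive.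
    apply supR_is_lub with (- a).
    - now exists (- q m i0), i0.
    - intros y [i ->]. specialize (Hab i). lra. }
  assert (Hqup : forall m i, q m i <= up m) by (intros m i; apply (Hup m); now exists i).
  assert (Hqlo : forall m i, lo m <= q m i).
  { intros m i. assert (- q m i <= - lo m); [|lra]. apply (Hlo m). now exists i. }
  assert (Hlo_ge : forall m c, (forall i, c <= q m i) -> c <= lo m).
  { intros m c Hc. assert (- lo m <= - c); [|lra].
    apply (Hlo m). intros y [i ->]. specialize (Hc i). lra. }
  assert (Hup_le : forall m c, (forall i, q m i <= c) -> up m <= c).
  { intros m c Hc. apply (Hup m). intros y [i ->]. apply Hc. }
  assert (Hqpos : forall m i, 0 < q m i).
  { intros m i. destruct (Q3 m) as [a [b [Ha Hab]]]. specialize (Hab i). lra. }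
  assert (Kq : forall i, Kinf (zpath (fun m => q m i))).
  { intros i. apply zpath_Kinf.
    - intros m. apply Hqpos.
    - intros m. destruct (Q1 m) as [d [Hd Hdd]]. specialize (Hdd i). lra.
    - intros eps He. destruct (Q4 (eps / 2) ltac:(lra)) as [m Hm]. exists m.
      specialize (Hm i). lra.
    - intros C. destruct (Q5 (C + 1)) as [m Hm]. exists m. specialize (Hm i). lra. }
  assert (Klo : Kinf (zpath lo)).
  { apply zpath_Kinf.
    - intros m. destruct (Q3 m) as [a [b [Ha Hab]]].
      apply Rlt_le_trans with (1 := Ha), Hlo_ge, Hab.
    - intros m. destruct (Q1 m) as [d [Hd Hdd]]. apply Rlt_le_trans with (lo m + d); [lra|].
      apply Hlo_ge. intros i. specialize (Hdd i). specialize (Hqlo m i). lra.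
    - intros eps He. destruct (Q4 (eps / 2) ltac:(lra)) as [m Hm]. exists m.
      specialize (Hm i0). specialize (Hqlo m i0). lra.
    - intros C. destruct (Q5 (C + 1)) as [m Hm]. exists m. specialize (Hlo_ge m _ Hm). lra. }
  assert (Kup : Kinf (zpath up)).
  { apply zpath_Kinf.
    - intros m. apply Rlt_le_trans with (1 := Hqpos m i0), Hqup.
    - intros m. destruct (Q1 m) as [d [Hd Hdd]].
      assert (up m <= up (m + 1)%Z - d); [|lra].
      apply Hup_le. intros i. specialize (Hdd i). specialize (Hqup (m + 1)%Z i). lra.
    - intros eps He. destruct (Q4 (eps / 2) ltac:(lra)) as [m Hm]. exists m.
      specialize (Hup_le m _ Hm). lra.
    - intros C. destruct (Q5 (C + 1)) as [m Hm]. exists m.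
      specialize (Hm i0). specialize (Hqup m i0). lra. }
  exists (fun r i => zpath (fun m => q m i) r).
  split; [|split; [|split]].
  - exists rho'. split; [assumption|]. intros r [Hr|<-] i.
    + rewrite zpath_pos_eq by assumption. set (t := r - / r).
      assert (Hstep : forall j, q (Int_part t) j <= q (Int_part t + 1)%Z j).
      { intros j. destruct (Q1 (Int_part t)) as [d [Hd Hdd]]. specialize (Hdd j). lra. }
      assert (Hbet : forall j : I, q (Int_part t) j <= lin_interp (fun m => q m j) t
                                 <= q (Int_part t + 1)%Z j).
      { intros j. specialize (Hstep j). apply interp_bounds; lra. }
      apply Rle_trans with (2 := proj1 (Hbet i)).
      apply Rle_trans with (2 := Q2 (Int_part t) i).
      apply Gam_rho_mono; trivial. intros j. rewrite zpath_pos_eq by assumption.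
      fold t. specialize (Hbet j). specialize (Hqpos (Int_part t) j). lra.
    + rewrite zpath_0, Gam_rho_0; trivial; [lra|]. intros j. apply zpath_0.
  - exists (zpath lo), (zpath up). split; [assumption|]. split; [assumption|].
    intros r _ i. split; apply zpath_le_compat; intros m; trivial.
  - assumption.
  - intros a b Ha Hab.
    (* The envelopes confine the preimages of [[a, b]] under all components to one interval
       [[xlo, xhi]]. *)
    destruct (Kfun_small (zpath up) a (proj1 Kup) Ha) as [xlo [Hxlo Hxloa]].
    destruct (proj2 Klo b) as [xhi [Hxhi Hxhib]].
    assert (Hrange : forall x i, 0 <= x -> a <= zpath (fun m => q m i) x <= b -> xlo <= x <= xhi).
    { intros x i Hx Hax.
      assert (L1 : zpath (fun m => q m i) x <= zpath up x)
        by (apply zpath_le_compat; intros m; apply Hqup).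
      assert (L2 : zpath lo x <= zpath (fun m => q m i) x)
        by (apply zpath_le_compat; intros m; apply Hqlo).
      split; apply Rnot_lt_le; intros Hlt.
      - pose proof (Kfun_le _ _ _ (proj1 Kup) Hx (Rlt_le _ _ Hlt)). lra.
      - pose proof (Kfun_le _ _ _ (proj1 Klo) Hxhi (Rlt_le _ _ Hlt)). lra. }
    destruct (zpath_window xlo xhi Hxlo) as [n Hn].
    destruct (Zrange_uniform (fun m c => forall i, c <= q (m + 1)%Z i - q m i <= / c) n Q1)
      as [c [Hc HP]].
    { intros m c c' Hc' Hcc H i. specialize (H i). split; [lra|].
      apply Rle_trans with (/ c); [apply H|]. apply Rinv_le_contravar; lra. }
    pose proof (Rinv_0_lt_compat _ Hc) as Hic.
    assert (Hxx : 0 < / (xlo * xlo)) by (apply Rinv_0_lt_compat; nra).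
    set (B := / c * (1 + / (xlo * xlo))).
    assert (HB : / c <= B) by (unfold B; nra).
    (* A preimage of [a] has its parameter in the window, so [0 <= n], and the increment at index
       [0] lies between [c] and [/ c]. This orders the two final constants. *)
    assert (Hcic : c <= / c).
    { destruct (Z_le_gt_dec 0 n) as [Hn0|Hn0].
      - specialize (HP 0%Z ltac:(lia) i0). lra.
      - exfalso. destruct (Kinf_surj _ a (Kq i0) (Rlt_le _ _ Ha)) as [x [Hx Hxa]].
        specialize (Hn x (Hrange x i0 Hx ltac:(lra))).
        assert (IZR n < IZR (- n)) by (apply IZR_lt; lia). lra. }
    (* On [[xlo, xhi]] the components have slopes between [c] and [B]; their inverses have the
       reciprocal slopes. *)
    exists (/ B), (/ c). split; [apply Rinv_0_lt_compat; lra|].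
    split; [apply Rinv_le_contravar; lra|].
    assert (Hmain : forall i x1 x2, xlo <= x1 -> x1 <= x2 -> x2 <= xhi ->
              let r1 := zpath (fun m => q m i) x1 in let r2 := zpath (fun m => q m i) x2 in
              / B * Rabs (r1 - r2) <= Rabs (x1 - x2) <= / c * Rabs (r1 - r2)).
    { intros i x1 x2 H1 H12 H2 r1 r2.
      pose proof (zpath_bilip (fun m => q m i) xlo xhi c (/ c) x1 x2 n Hxlo Hn
                    (Rlt_le _ _ Hc) (Rlt_le _ _ Hic) ltac:(intros; now apply HP) H1 H12 H2) as K.
      fold r1 r2 B in K. rewrite (Rabs_left1 (x1 - x2)) by lra.
      rewrite (Rabs_left1 (r1 - r2)) by nra. split.
      - apply Rmult_le_reg_l with B; [lra|]. rewrite <- Rmult_assoc, Rinv_r by lra. lra.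
      - apply Rmult_le_reg_l with c; [lra|]. rewrite <- Rmult_assoc, Rinv_r by lra. lra. }
    intros i r1 r2 x1 x2 Hr1 Hr2 Hx1 Hx2 E1 E2.
    pose proof (Hrange x1 i Hx1 ltac:(rewrite E1; assumption)) as X1.
    pose proof (Hrange x2 i Hx2 ltac:(rewrite E2; assumption)) as X2.
    destruct (Rle_dec x1 x2) as [Hle|Hgt].
    + specialize (Hmain i x1 x2 ltac:(lra) Hle ltac:(lra)). simpl in Hmain.
      now rewrite E1, E2 in Hmain.
    + specialize (Hmain i x2 x1 ltac:(lra) ltac:(lra) ltac:(lra)). simpl in Hmain.
      rewrite E1, E2 in Hmain. now rewrite (Rabs_minus_sym r1), (Rabs_minus_sym x1).
Qed.

(** * From a path of strict decay to UGAS *)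

Lemma KL_comp (f psi : R -> R) (h : R -> R -> R) :
  Kfun f -> Kfun psi -> KLfun h -> KLfun (fun r t => f (h (psi r) t)).
Proof.
  intros Hf Hpsi [Hc [HK Hd]].
  assert (Hh : forall r t, 0 <= r -> 0 <= t -> 0 <= h (psi r) t).
  { intros r t Hr Ht. apply (Kfun_nonneg (fun r => h r t)); [now apply HK|].
    now apply Kfun_nonneg. }
  split; [|split].
  - intros r t Hr Ht eps He.
    destruct (proj2 (proj2 Hf) (h (psi r) t) (Hh r t Hr Ht) eps He) as [d1 [Hd1 H1]].
    destruct (Hc (psi r) t (Kfun_nonneg _ _ Hpsi Hr) Ht d1 Hd1) as [d2 [Hd2 H2]].
    destruct (proj2 (proj2 Hpsi) r Hr d2 Hd2) as [d3 [Hd3 H3]].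
    exists (Rmin d2 d3). split; [now apply Rmin_pos|].
    intros r' t' Hr' Ht' Hrr Htt. apply H1; [now apply Hh|].
    apply H2; trivial.
    + now apply Kfun_nonneg.
    + apply H3; trivial. apply Rlt_le_trans with (1 := Hrr), Rmin_r.
    + apply Rlt_le_trans with (1 := Htt), Rmin_l.
  - intros t Ht. apply (Kfun_comp f (fun r => h (psi r) t)); [assumption|].
    apply (Kfun_comp (fun r => h r t) psi); [now apply HK | assumption].
  - intros r Hr. pose proof (Kfun_pos psi r Hpsi Hr) as Hp.
    destruct (Hd (psi r) Hp) as [D1 D2]. split.
    + intros t1 t2 Ht Ht12. apply (proj1 (proj2 Hf)); [apply Hh; lra | now apply D1].
    + intros eps He. destruct (Kfun_small f eps Hf He) as [d [Hdp Hde]].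
      destruct (D2 d Hdp) as [T [HT HTT]]. exists T. split; [assumption|].
      intros t Ht. specialize (HTT t Ht). apply Rabs_def2 in HTT.
      pose proof (Hh r t ltac:(lra) ltac:(lra)) as Hn.
      rewrite Rabs_pos_eq by now apply Kfun_nonneg.
      apply Rle_lt_trans with (2 := Hde). apply Kfun_le; trivial; lra.
Qed.

Lemma Kfun_iter (g : R -> R) (n : nat) : Kfun g -> Kfun (fun r => Nat.iter n g r).
Proof.
  intros Hg. induction n as [|n IH]; [exact Kfun_id|].
  exact (Kfun_comp g _ Hg IH).
Qed.

(** If the infimum [L] of the iterates were positive, then [g L < L], and continuity would send an
    iterate close to [L] below [L]. *)
Lemma iter_tends_0 (g : R -> R) (r eps : R) :
  Kfun g -> (forall x, 0 < x -> g x < x) -> 0 <= r -> 0 < eps ->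
  exists n, Nat.iter n g r < eps.
Proof.
  intros Hg Hlt Hr He. apply NNPP. intros Hno.
  assert (Hge : forall n, eps <= Nat.iter n g r).
  { intros n. apply Rnot_lt_le. intros H. apply Hno. now exists n. }
  set (E := fun y => exists n, y = - Nat.iter n g r).
  assert (HE : is_lub E (supR E)).
  { apply supR_is_lub with (- eps); [now exists (- r), 0%nat|].
    intros y [n ->]. specialize (Hge n). lra. }
  destruct HE as [Hub Hlub]. set (L := - supR E).
  assert (HL : eps <= L).
  { unfold L. assert (supR E <= - eps); [|lra]. apply Hlub. intros y [n ->].
    specialize (Hge n). lra. }
  assert (HLn : forall n, L <= Nat.iter n g r).
  { intros n. unfold L. assert (- Nat.iter n g r <= supR E); [|lra]. apply Hub. now exists n. }
  specialize (Hlt L ltac:(lra)).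
  destruct (proj2 (proj2 Hg) L ltac:(lra) (L - g L) ltac:(lra)) as [d [Hd Hdd]].
  assert (Hn : exists n, Nat.iter n g r < L + d).
  { apply NNPP. intros Hn. assert (supR E <= - (L + d)); [|unfold L in *; lra].
    apply Hlub. intros y [n ->]. assert (~ Nat.iter n g r < L + d); [|lra].
    intros H. apply Hn. now exists n. }
  destruct Hn as [n Hn]. pose proof (HLn n) as H1. pose proof (HLn (S n)) as H2. simpl in H2.
  specialize (Hdd (Nat.iter n g r) ltac:(lra) ltac:(apply Rabs_def1; lra)).
  apply Rabs_def2 in Hdd. lra.
Qed.

(** Linear interpolation in time of the iterates: nonincreasing and [r]-Lipschitz in [t], and for
    fixed [t] a convex combination of two class-K functions of [r]. *)
Lemma Kfun_iter_KL (g : R -> R) :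
  Kfun g -> (forall x, 0 < x -> g x < x) ->
  exists h, KLfun h /\ forall r n, h r (INR n) = Nat.iter n g r.
Proof.
  intros Hg Hlt.
  assert (Hle : forall x, 0 <= x -> g x <= x).
  { intros x [Hx|<-]; [now apply Rlt_le, Hlt | rewrite (proj1 Hg); lra]. }
  set (q := fun r m => Nat.iter (Z.to_nat m) g r).
  assert (Hqpos : forall r m, 0 <= r -> 0 <= q r m).
  { intros r m Hr. apply (Kfun_nonneg (fun r => Nat.iter (Z.to_nat m) g r)); trivial.
    now apply Kfun_iter. }
  assert (Hqstep : forall r m, (0 <= m)%Z -> q r (m + 1)%Z = g (q r m)).
  { intros r m Hm. unfold q. rewrite Z2Nat.inj_add by lia. rewrite Nat.add_comm. reflexivity. }
  assert (Hqle : forall r m, 0 <= r -> q r m <= r).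
  { intros r m Hr. unfold q. induction (Z.to_nat m) as [|n IH]; [simpl; lra|]. simpl.
    apply Rle_trans with (2 := IH), Hle.
    apply (Kfun_nonneg (fun r => Nat.iter n g r)); trivial. now apply Kfun_iter. }
  assert (HqK : forall m, Kfun (fun r => q r m)) by (intros m; now apply Kfun_iter).
  assert (Hlip : forall r t1 t2, 0 <= r -> 0 <= t1 -> t1 <= t2 ->
            0 <= lin_interp (q r) t1 - lin_interp (q r) t2 <= r * (t2 - t1)).
  { intros r t1 t2 Hr H1 H12. destruct (IZR_above t2) as [n [Hn0 Hn]].
    assert (Hstep : forall m, (0 <= m <= n)%Z -> - r <= q r (m + 1)%Z - q r m <= 0).
    { intros m Hm. pose proof (Hqpos r (m + 1)%Z Hr). pose proof (Hqle r m Hr).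
      split; [lra|]. rewrite Hqstep by lia. specialize (Hle (q r m) (Hqpos r m Hr)). lra. }
    pose proof (interp_slope_ge (q r) (- r) 0 n t1 t2 ltac:(intros; now apply Hstep) H1 H12 Hn).
    pose proof (interp_slope_le (q r) 0 0 n t1 t2 ltac:(intros; now apply Hstep) H1 H12 Hn).
    lra. }
  assert (HK : forall t, 0 <= t -> Kfun (fun r => lin_interp (q r) t)).
  { intros t Ht. pose proof (interp_weight t) as W. set (w := t - IZR (Int_part t)) in *.
    pose proof (Kfun_conic (fun r => q r (Int_part t)) (fun r => q r (Int_part t + 1)%Z)
                  (1 - w) w (HqK _) (HqK _) ltac:(lra) ltac:(lra) ltac:(lra)) as [K0 [K1 K2]].
    assert (E : forall r, lin_interp (q r) t
                = (1 - w) * q r (Int_part t) + w * q r (Int_part t + 1)%Z)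
      by (intros r; unfold lin_interp; fold w; ring).
    split; [now rewrite E|]. split.
    - intros x y Hx Hxy. rewrite !E. now apply K1.
    - intros x Hx eps He. destruct (K2 x Hx eps He) as [d [Hd Hdd]]. exists d.
      split; [assumption|]. intros y Hy Hyx. rewrite !E. now apply Hdd. }
  exists (fun r t => lin_interp (q r) t). split; [split; [|split]|].
  - intros r t Hr Ht eps He.
    destruct (proj2 (proj2 (HK t Ht)) r Hr (eps / 2) ltac:(lra)) as [d [Hd Hdd]].
    assert (Hd2 : 0 < eps / 2 / (r + 1)) by (apply Rdiv_lt_0_compat; lra).
    (* The bound [1] gives [r' < r + 1], hence a Lipschitz constant in [t] common to all nearby
       [r']. *)
    exists (Rmin 1 (Rmin d (eps / 2 / (r + 1)))).
    pose proof (Rmin_l 1 (Rmin d (eps / 2 / (r + 1)))) as M1.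
    pose proof (Rmin_r 1 (Rmin d (eps / 2 / (r + 1)))) as M2.
    pose proof (Rmin_l d (eps / 2 / (r + 1))) as M3.
    pose proof (Rmin_r d (eps / 2 / (r + 1))) as M4.
    split; [repeat apply Rmin_pos; lra|].
    intros r' t' Hr' Ht' Hrr Htt.
    specialize (Hdd r' Hr' ltac:(lra)). apply Rabs_def2 in Hdd.
    apply Rabs_def2 in Hrr.
    assert (Hb : Rabs (lin_interp (q r') t' - lin_interp (q r') t) <= (r + 1) * Rabs (t' - t)).
    { apply Rle_trans with (r' * Rabs (t' - t)).
      - destruct (Rle_dec t t') as [Htle|Htgt].
        + pose proof (Hlip r' t t' Hr' Ht Htle).
          rewrite (Rabs_left1 (lin_interp _ _ - _)), (Rabs_pos_eq (t' - t)) by lra. lra.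
        + pose proof (Hlip r' t' t Hr' Ht' ltac:(lra)).
          rewrite (Rabs_pos_eq (lin_interp _ _ - _)), (Rabs_left1 (t' - t)) by lra. lra.
      - apply Rmult_le_compat_r; [apply Rabs_pos | lra]. }
    assert (Hb2 : (r + 1) * Rabs (t' - t) < eps / 2).
    { replace (eps / 2) with ((r + 1) * (eps / 2 / (r + 1))) by (field; lra).
      apply Rmult_lt_compat_l; lra. }
    assert (Hb3 : Rabs (lin_interp (q r') t' - lin_interp (q r') t) < eps / 2) by lra.
    apply Rabs_def2 in Hb3. apply Rabs_def1; lra.
  - assumption.
  - intros r Hr. split.
    + intros t1 t2 Ht Ht12. destruct (IZR_above t2) as [n [Hn0 Hn]].
      (* The drops up to index [n] have a common positive lower bound. At negative indices
         [Z.to_nat] makes [q r] constant, hence the guard. *)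
      destruct (Zrange_uniform (fun m c => (0 <= m)%Z -> q r (m + 1)%Z - q r m <= - c) n)
        as [c [Hc HP]].
      * intros m. destruct (Z_le_gt_dec 0 m) as [Hm|Hm]; [|exists 1; split; [lra | lia]].
        exists (q r m - q r (m + 1)%Z). split; [|lra]. rewrite Hqstep by assumption.
        assert (0 < q r m) by (apply (Kfun_pos (fun r => q r m)); trivial).
        specialize (Hlt (q r m) H). lra.
      * intros m c c' Hc' Hcc H Hm. specialize (H Hm). lra.
      * pose proof (interp_slope_le (q r) (- c) 0 n t1 t2) as K.
        specialize (K ltac:(intros m Hm; apply HP; lia) Ht ltac:(lra) Hn). nra.
    + intros eps He. destruct (iter_tends_0 g r eps Hg Hlt (Rlt_le _ _ Hr) He) as [n Hn].
      exists (INR n). split; [apply pos_INR|]. intros t Ht.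
      pose proof (pos_INR n) as Hn0.
      pose proof (Hlip r (INR n) t ltac:(lra) Hn0 Ht) as K.
      rewrite (INR_IZR_INZ n) in K at 1. rewrite interp_IZR in K.
      unfold q at 1 in K. rewrite Nat2Z.id in K.
      pose proof (Kfun_nonneg _ r (HK t ltac:(lra)) (Rlt_le _ _ Hr)) as K0.
      simpl in K0. rewrite Rabs_pos_eq; lra.
  - intros r n. rewrite INR_IZR_INZ, interp_IZR. unfold q. now rewrite Nat2Z.id.
Qed.

Lemma path_UGAS (I : Type) (i0 : I) (Ii : I -> list I) (gam : I -> I -> R -> R)
  (sigma : R -> I -> R) :
  max_type_gain Ii gam -> path_strict_decay Ii gam sigma ->
  exists rho, Kinf rho /\ UGAS (Gam_rho Ii gam rho).
Proof.
  intros Hg [[rho [Hrinf Hdecay]] [[phimin [phimax [Kmin [Kmax Hphi]]]] [Hsig Hlip]]].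
  pose proof (proj1 Hrinf) as Hr. pose proof (Kinf_half rho Hrinf) as Hr'inf.
  pose proof (proj1 Hr'inf) as Hr'.
  exists (fun x => rho x / 2). split; [assumption|].
  set (rho' := fun x => rho x / 2) in *. set (T := Gam_rho Ii gam rho').
  destruct (half_gain_lipschitz_rate rho Hr) as [alpha [A1 [A2 [_ A4]]]].
  assert (Hspos : forall r i, 0 <= r -> 0 <= sigma r i).
  { intros r i Hrr. apply (Kfun_nonneg (fun r => sigma r i)); [apply Hsig | assumption]. }
  assert (Hsmono : forall r r' i, 0 <= r -> r <= r' -> sigma r i <= sigma r' i).
  { intros r r' i Hrr Hrr'. apply (Kfun_le (fun r => sigma r i)); trivial. apply Hsig. }
  assert (HT : forall r i, 0 <= r -> T (sigma r) i <= sigma r i - alpha (sigma r i)).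
  { intros r i Hrr. apply A4; [apply Gam_nonneg | now apply Hdecay]. }
  (* The shifts [d] of the path parameter that one application of [T] permits at [r], for all
     vertices at once. *)
  set (E := fun r d => 0 <= d <= r /\ forall i, T (sigma r) i <= sigma (r - d) i).
  assert (HE0 : forall r, 0 <= r -> E r 0).
  { intros r Hrr. split; [lra|]. intros i. rewrite Rminus_0_r.
    apply Rle_trans with (1 := HT r i Hrr). specialize (A2 (sigma r i) (Hspos r i Hrr)). lra. }
  assert (HElub : forall r, 0 <= r -> is_lub (E r) (supR (E r))).
  { intros r Hrr. apply supR_is_lub with r; [exists 0; now apply HE0|].
    intros d [Hd _]. lra. }
  destruct (lipschitz_minorant (fun r => supR (E r))) as [F [F0 [F1 [F2 F3]]]].
  { apply Rle_antisym.
    - apply (HElub 0 (Rle_refl 0)). intros d [Hd _]. lra.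
    - apply (HElub 0 (Rle_refl 0)), HE0. lra. }
  { intros r Hrr. apply (HElub r Hrr), HE0, Hrr. }
  { intros a b Ha Hab.
    assert (Hla : 0 < phimin (a / 2)) by (apply Kfun_pos; [apply Kmin | lra]).
    assert (Hla' : phimin (a / 2) <= phimin a) by (apply Kfun_le; [apply Kmin | lra | lra]).
    assert (Hlb : phimin a <= phimax b).
    { apply Rle_trans with (1 := proj1 (Hphi a (Rlt_le _ _ Ha) i0)).
      apply Rle_trans with (sigma b i0); [apply Hsmono; lra | apply Hphi; lra]. }
    destruct (A1 (phimin a) (phimax b) ltac:(lra) Hlb) as [c [Hc Hcc]].
    (* A shift [d <= a / 2] keeps both values in this range. There [l * (sigma r i - sigma (r - d)
       i) <= d <= l * c], so the path drops by at most the decay rate [c]. *)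
    destruct (Hlip (phimin (a / 2)) (phimax b) Hla ltac:(lra)) as [l [L [Hl [_ HlL]]]].
    exists (Rmin (a / 2) (l * c)). split; [apply Rmin_pos; [lra | nra]|].
    intros r Hrab. apply (HElub r ltac:(lra)).
    assert (D0 : 0 < Rmin (a / 2) (l * c)) by (apply Rmin_pos; [lra | nra]).
    pose proof (Rmin_l (a / 2) (l * c)) as D1. pose proof (Rmin_r (a / 2) (l * c)) as D2.
    set (d := Rmin (a / 2) (l * c)) in *.
    split; [lra|]. intros i.
    apply Rle_trans with (1 := HT r i ltac:(lra)).
    assert (B1 : phimin a <= sigma r i <= phimax b).
    { split.
      - apply Rle_trans with (sigma a i); [apply Hphi; lra | apply Hsmono; lra].
      - apply Rle_trans with (sigma b i); [apply Hsmono; lra | apply Hphi; lra]. }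
    specialize (Hcc (sigma r i) B1).
    assert (B2 : phimin (a / 2) <= sigma (r - d) i <= phimax b).
    { split.
      - apply Rle_trans with (sigma (a / 2) i); [apply Hphi; lra | apply Hsmono; lra].
      - apply Rle_trans with (sigma b i); [apply Hsmono; lra | apply Hphi; lra]. }
    pose proof (Hsmono (r - d) r i ltac:(lra) ltac:(lra)) as Hm.
    destruct (HlL i (sigma r i) (sigma (r - d) i) r (r - d) ltac:(lra) B2
                ltac:(lra) ltac:(lra) eq_refl eq_refl) as [HL _].
    rewrite (Rabs_pos_eq (sigma r i - _)) in HL by lra.
    rewrite Rabs_pos_eq in HL by lra.
    assert (sigma r i - sigma (r - d) i <= c); [|lra].
    apply Rmult_le_reg_l with l; [assumption | lra]. }
  assert (Fpos : forall x, 0 < x -> 0 < F x).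
  { intros x Hx. destruct (F1 x x Hx (Rle_refl x)) as [c [Hc Hcx]].
    specialize (Hcx x ltac:(lra)). lra. }
  (* Halving makes [g] strictly increasing, since [F] is 1-Lipschitz, and leaves room below a
     supremum of shifts that may not be attained. *)
  set (g := fun r => r - F r / 2).
  assert (Hg0 : g 0 = 0) by (unfold g; rewrite F0; lra).
  assert (Hginc : forall x y, 0 <= x -> x < y -> g x < g y).
  { intros x y Hx Hxy. specialize (F3 y x ltac:(lra) Hx).
    rewrite (Rabs_pos_eq (y - x)) in F3 by lra. apply Rabs_le_between in F3. unfold g. lra. }
  assert (HKg : Kfun g).
  { split; [assumption|]. split; [assumption|].
    intros x Hx eps He. exists (eps / 2). split; [lra|]. intros y Hy Hyx.
    specialize (F3 y x Hy Hx). unfold g.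
    replace (y - F y / 2 - (x - F x / 2)) with ((y - x) + - ((F y - F x) / 2)) by field.
    apply Rle_lt_trans with (1 := Rabs_triang _ _).
    rewrite Rabs_Ropp. unfold Rdiv. rewrite Rabs_mult, (Rabs_pos_eq (/ 2)) by lra. lra. }
  assert (Hglt : forall x, 0 < x -> g x < x).
  { intros x Hx. specialize (Fpos x Hx). unfold g. lra. }
  assert (HTg : forall r i, 0 <= r -> T (sigma r) i <= sigma (g r) i).
  { intros r i [Hrr|<-].
    - specialize (F2 r (Rlt_le _ _ Hrr)). specialize (Fpos r Hrr).
      assert (Hd : exists d, E r d /\ F r / 2 < d).
      { apply NNPP. intros Hn. assert (supR (E r) <= F r / 2); [|lra].
        apply (HElub r (Rlt_le _ _ Hrr)). intros d Hd. apply Rnot_lt_le. intros Hlt.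
        apply Hn. now exists d. }
      destruct Hd as [d [[Hd1 Hd2] Hd3]].
      apply Rle_trans with (1 := Hd2 i). apply Hsmono; [lra|]. unfold g. lra.
    - rewrite Hg0. destruct (HE0 0 (Rle_refl 0)) as [_ H].
      rewrite Rminus_diag in H. apply H. }
  (* [psi] selects the path parameter at which [sigma] dominates a given state. *)
  destruct (Kinf_inverse phimin Kmin) as [psi [Kpsi Hpsi]].
  destruct (Kfun_iter_KL g HKg Hglt) as [h [HKL Hh]].
  exists (fun r t => phimax (h (psi r) t)).
  split; [apply KL_comp; trivial; apply Kmax|].
  intros s Hs n. rewrite Hh.
  destruct (Hpsi (snorm s) (snorm_nonneg I i0 s Hs)) as [HR Hpsis].
  set (r := psi (snorm s)) in *.
  assert (Hit : forall k, 0 <= Nat.iter k g r).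
  { intros k. apply (Kfun_nonneg (fun r => Nat.iter k g r)); trivial. now apply Kfun_iter. }
  assert (Hcmp : forall k i, 0 <= Nat.iter k T s i <= sigma (Nat.iter k g r) i).
  { induction k as [|k IH]; intros i; simpl.
    - split; [apply Hs|]. apply Rle_trans with (1 := le_snorm I s i Hs).
      rewrite <- Hpsis. apply Hphi, HR.
    - split; [now apply Gam_rho_nonneg|].
      apply Rle_trans with (T (sigma (Nat.iter k g r)) i); [|now apply HTg].
      apply Gam_rho_mono; trivial. }
  apply (snorm_le I i0). intros i. split; [apply Hcmp|].
  apply Rle_trans with (1 := proj2 (Hcmp n i)). apply Hphi, Hit.
Qed.

Theorem theorem4p1 (I : Type) (i0 : I)
  (Icount : exists f : I -> nat, forall x y, f x = f y -> x = y)
  (Ii : I -> list I) (gam : I -> I -> R -> R)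
  (Hgain : max_type_gain Ii gam) :
  ((exists sigma, path_strict_decay Ii gam sigma) <->
   (exists rho, Kinf rho /\ UGAS (Gam_rho Ii gam rho))) /\
  (assumptionA Ii gam ->
   (exists M, 0 < M /\ forall i, INR (length (Ii i)) <= M) ->
   ((exists sigma, path_strict_decay Ii gam sigma) <->
    (exists rho, Kinf rho /\ trajectories_bounded (Gam_rho Ii gam rho) /\
                 uniform_NJI Ii (Gam_rho Ii gam rho)))).
Proof.
  split; [split|intros _ [M [_ HM]]; split].
  - intros [sigma Hsigma]. now apply (path_UGAS I i0 Ii gam sigma).
  - intros [rho [Hrho HU]]. apply (attractive_path I i0 Ii gam rho); trivial.
    apply (UGAS_attractive I i0); trivial. apply Hrho.
  - intros [sigma Hsigma].
    destruct (path_UGAS I i0 Ii gam sigma Hgain Hsigma) as [rho [Hrho HU]].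
    exists rho. split; [assumption|]. split; [now apply (UGAS_bounded I i0)|].
    apply attractive_uniform_NJI; [assumption | apply Hrho |].
    apply (UGAS_attractive I i0); trivial. apply Hrho.
  - intros [rho [Hrho [Htb HNJI]]].
    destruct (INR_unbounded M) as [k Hk].
    (* The passage from NJI to attractivity has already halved [rho]; the path construction halves
       it once more. *)
    apply (attractive_path I i0 Ii gam (fun x => rho x / 2)); trivial; [now apply Kinf_half|].
    apply (NJI_attractive I Ii gam rho k); trivial.
    intros i. apply INR_le. specialize (HM i). lra.
Qed.
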